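(* Let $P$ be a simplicial polytope and let $F$ and $G$ be any two distinct facets of $P$. Then the cover graph of the face lattice $\mathcal{L}(P)$ admits a Hamilton cycle in which the two neighbors of the vertex $P$ (the top element of $\mathcal{L}(P)$) are $F$ and $G$.
   Context: A polytope is the convex hull of finitely many points in some Euclidean space. The face lattice $\mathcal{L}(P)$ of a polytope $P$ is the set of all faces of $P$, including the empty face $\emptyset$ and $P$ itself, ordered by inclusion. If $P$ has dimension $d$, its facets are its faces of dimension $d-1$ (the empty face has dimension $-1$). A polytope is simplicial if all its facets are simplices. For a poset $(\mathcal{P},<)$, a cover relation is a pair $x,y\in\mathcal{P}$ with $x<y$ such that there is no $z\in\mathcal{P}$ with $x<z<y$; the cover graph of $\mathcal{P}$ is the undirected graph whose vertices are the elements of $\mathcal{P}$ and whose edges are the cover relations of $\mathcal{P}$. In $\mathcal{L}(P)$ the cover relations are the pairs of faces, one contained in the other, whose dimensions differ by $1$. A Hamilton cycle of a graph is a cycle that visits every vertex exactly once. *)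

(* Defs.v *)
From mathcomp Require Import all_boot all_order all_algebra.
From mathcomp Require Import all_classical all_reals convex.

Set Implicit Arguments.
Unset Strict Implicit.
Unset Printing Implicit Defensive.

Import Order.TTheory GRing.Theory Num.Theory.

Local Open Scope classical_set_scope.
Local Open Scope ring_scope.

Section Graphs.

(* [L] is viewed as a poset with the order induced from [T]: the elements
   strictly in between range over [L], not over all of [T]. *)
Definition covers d (T : porderType d) (L : set T) (x y : T) : Prop :=
  [/\ L x, L y, (x < y)%O & ~ exists z, [/\ L z, (x < z)%O & (z < y)%O]].

Definition cover_adj d (T : porderType d) (L : set T) (x y : T) : Prop :=
  covers L x y \/ covers L y x.

(* A cycle is given by the list of its vertices in cyclic order; consecutive
   ones, as well as the last and the first, are adjacent. *)
Definition hamilton_cycle (T : eqType) (V : set T) (adj : T -> T -> Prop)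
    (c : seq T) : Prop :=
  [/\ ucycle [rel x y | `[< adj x y >]] c, (2 < size c)%N & [set` c] = V].

End Graphs.

Section Polytopes.
Variables (R : realType) (n : nat).
Implicit Types A P F : set 'rV[R]_n.

Definition convex_hull A : set 'rV[R]_n :=
  smallest (@convex_set R 'rV[R]_n) A.

Definition affine_hull A : set 'rV[R]_n :=
  [set x | exists k (v : 'I_k -> 'rV[R]_n) (a : 'I_k -> R),
    [/\ forall i, A (v i), \sum_i a i = 1 & x = \sum_i a i *: v i]].

Definition polytope P : Prop :=
  exists2 V, finite_set V & P = convex_hull V.

(* The case [c = 0] yields the improper faces: [P] itself for [b = 0] and the
   empty face for [b = 1]. *)
Definition face P F : Prop :=
  exists (c : 'cV[R]_n) (b : R),
    (forall x, P x -> (x *m c) 0 0 <= b) /\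
    F = [set x | P x /\ (x *m c) 0 0 = b].

(* The order on sets is inclusion. *)
Definition face_lattice P : set (set 'rV[R]_n) := [set F | face P F].

Definition has_dim A (d : int) : Prop :=
  (A = set0 /\ d = -1) \/
  exists (x : 'rV[R]_n) (U : {vspace 'rV[R]_n}),
    affine_hull A = [set x + u | u in [set` U]] /\ d = (\dim U)%:Z.

Definition facet P F : Prop :=
  face P F /\ exists2 d : int, has_dim P d & has_dim F (d - 1).

Definition affinely_independent k (v : 'I_k -> 'rV[R]_n) : Prop :=
  forall a : 'I_k -> R,
    \sum_i a i = 0 -> \sum_i a i *: v i = 0 -> forall i, a i = 0.

(* A simplex of dimension [k - 1]; the empty set, as the only facet of a point,
   is the simplex with [k = 0]. *)
Definition simplex A : Prop :=
  exists k (v : 'I_k -> 'rV[R]_n),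
    affinely_independent v /\ A = convex_hull (range v).

Definition simplicial P : Prop := forall F, facet P F -> simplex F.

End Polytopes.

(* Main.v *)
Require Import Defs.
From mathcomp Require Import all_boot all_order all_algebra.
From mathcomp Require Import all_classical all_reals convex.
From mathcomp Require Import interval_inference ring lra.
From mathcomp Require Import seq fintype finset.

Set Implicit Arguments.
Unset Strict Implicit.
Unset Printing Implicit Defensive.

Import Order.TTheory GRing.Theory Num.Theory.

(** Write a face of P, other than P itself, as the set of the vertices of P that
    it contains. As the facets are simplices, these sets are exactly the subsets
    of the vertex sets of facets, and two of them form a cover relation when
    they differ by one vertex. So it suffices to walk through the boundary
    complex from F to G, adding or removing one vertex at each step and
    meeting every face once: P closes the cycle.

    The boundary complex is shelled by a sweep along a generic line through an
    interior point of F and an interior point of G ([sweep_shelling]): the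
    facets are taken in the order in which the line meets their hyperplanes, F
    first and G last. When a facet A is added, the faces of A that are new are
    those that contain some set R, so they form a Boolean cube; R = A happens
    only for G. The reason is that every facet function is a multiple of
    that of A plus a combination with nonnegative coefficients of those of the
    neighbours of A ([facet_local_min]), hence a facet that precedes all its
    neighbours around a face precedes all the facets around that face.

    The walk grows along the shelling ([partial_walk_step]). It always ends at
    a ridge on the boundary of the part already covered, and the boundary
    ridges are kept in a list that starts with this end. Every other ridge H of
    the list is next to some H \ y in the walk, where H \ y is not contained in
    any later ridge of the list. When the facet A arrives, let A \ a be the
    first listed ridge inside A. If it is the end of the walk, a Hamilton path
    of the new cube from A to some A \ b prolongs the walk. Otherwise it is next
    to A \ a \ y, and y is not in R because A \ y would be a later ridge
    containing A \ a \ y. So a Hamilton path of the cube from A to A \ y fits in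
    between A \ a and A \ a \ y. When G arrives, R = G leaves no such y;
    the walk therefore ends at a ridge of G, and G is appended.

    On the geometric side, the polytope is the hull of a minimal family of
    points, and a face is the zero set of an affine function that is nonnegative
    on these points. Facets correspond to the nonzero such functions
    that are determined up to a scalar by their zeros ([facet_hullP]); facets
    are simplices, so each of their vertices has an affine coordinate function
    ([simplex_coords]). Everything about facets and their neighbours
    then follows by adding multiples of such functions. *)

(** * Splicing walks *)

Section Walks.
Variables (T : eqType) (e : rel T).
Hypothesis e_sym : symmetric e.
Implicit Types (s c : seq T) (x y z : T).

Definition links s := zip s (behead s).

Definition consecutive s x y := ((x, y) \in links s) || ((y, x) \in links s).

Lemma consecutiveC s x y : consecutive s x y = consecutive s y x.
Proof. by rewrite /consecutive orbC. Qed.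

Lemma links_cat s1 a s2 :
  links (s1 ++ a :: s2) = links (rcons s1 a) ++ links (a :: s2).
Proof.
elim: s1 => [|x s1 IH] //=.
by case: s1 IH => [|y s1] //= IH; rewrite /links /= in IH *; rewrite IH.
Qed.

Lemma links_rcons s a b :
  links (rcons (a :: s) b) = rcons (links (a :: s)) (last a s, b).
Proof.
elim: s a => [|x s IH] a //=.
by rewrite -[links _ in LHS]/((a, x) :: links (rcons (x :: s) b)) IH.
Qed.

Lemma links_split s a b : (a, b) \in links s ->
  exists s1 s2, s = s1 ++ a :: b :: s2.
Proof.
elim: s => [|x s IH] //; case: s IH => [|y s] //= IH.
rewrite /links /= inE => /orP[/eqP[-> ->]|/IH[s1 [s2 E]]].
  by exists [::], s.
by exists (x :: s1), s2; rewrite E.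
Qed.

Lemma sorted_links s : sorted e s = all (fun p => e p.1 p.2) (links s).
Proof.
elim: s => [|x s IH] //; case: s IH => [|y s] //= IH.
by rewrite /links /= in IH *; rewrite IH.
Qed.

Lemma links_rev s x y : ((x, y) \in links (rev s)) = ((y, x) \in links s).
Proof.
elim: s => [|z s IH] //; case: s IH => [|t s] // IH.
rewrite rev_cons; case E: (rev _) => [|a u].
  by move/(congr1 size): E; rewrite size_rev.
have lu : last a u = t.
  by rewrite -[last a u]/(last a (a :: u)) -E rev_cons last_rcons.
rewrite links_rcons lu mem_rcons inE -E IH.
by rewrite /links /= inE !xpair_eqE andbC.
Qed.

Lemma consecutive_rev s x y : consecutive (rev s) x y = consecutive s x y.
Proof. by rewrite /consecutive !links_rev orbC. Qed.

Lemma sub_consecutive s s' x y :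
  {subset links s <= links s'} -> consecutive s x y -> consecutive s' x y.
Proof. by move=> sub /orP[]/sub h; rewrite /consecutive h ?orbT. Qed.

Lemma consecutive_mem s x y : consecutive s x y -> (x \in s) && (y \in s).
Proof.
by case/orP=> /links_split[s1 [s2 ->]]; rewrite !mem_cat !inE !eqxx ?orbT.
Qed.

Lemma links_prefix s c : {subset links s <= links (s ++ c)}.
Proof.
case: c => [|y c] z zs; first by rewrite cats0.
case/lastP: s zs => // s x zs.
by rewrite cat_rcons links_cat mem_cat zs.
Qed.

Lemma links_suffix s c : {subset links c <= links (s ++ c)}.
Proof. by case: c => [|y c] z // zc; rewrite links_cat mem_cat zc orbT. Qed.

Lemma sorted_cat x0 s c : s != [::] -> c != [::] -> sorted e s -> sorted e c ->
  e (last x0 s) (head x0 c) -> sorted e (s ++ c).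
Proof. by case: s c => [|x s] [|y c] //= _ _; rewrite cat_path /= => -> -> ->. Qed.

(** Everything about a walk is read off its list of links, and the links of the
    new walk are those of both pieces, without the link that has been cut. *)
Lemma splice_directed x0 s1 s2 c a b :
  let s := s1 ++ a :: b :: s2 in let s' := s1 ++ a :: c ++ b :: s2 in
  c != [::] -> sorted e s -> sorted e c ->
  e a (head x0 c) -> e (last x0 c) b ->
  [/\ sorted e s', perm_eq s' (s ++ c),
      head x0 s' = head x0 s & last x0 s' = last x0 s] /\
  [/\ forall x y, (x, y) \in links s -> (x, y) != (a, b) ->
        (x, y) \in links s',
      {subset links c <= links s'}, (a, head x0 c) \in links s' &
      (last x0 c, b) \in links s'].
Proof.
case/lastP: c => // c y.
case: (rcons c y) (last_rcons x0 c y) (size_rcons c y) => // x d ly _.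
rewrite /= in ly; cbv zeta; rewrite /=.
move=> _ srt srtc eax; rewrite ly => eyb.
set s := s1 ++ [:: a, b & s2] in srt *.
set s' := s1 ++ [:: a, x & d ++ b :: s2].
have Ls : links s = links (rcons s1 a) ++ (a, b) :: links (b :: s2).
  by rewrite /s links_cat.
have Ls' : links s' = links (rcons s1 a) ++ (a, x) :: links (x :: d)
                       ++ (y, b) :: links (b :: s2).
  rewrite /s' links_cat; congr (_ ++ _).
  rewrite -[LHS]/((a, x) :: links ((x :: d) ++ b :: s2)) links_cat links_rcons.
  by rewrite ly cat_rcons.
split; split.
- rewrite sorted_links Ls' all_cat /= all_cat /= eax eyb.
  move: srt srtc; rewrite -[path e x d]/(sorted e (x :: d)) !sorted_links.
  rewrite Ls all_cat /= => /and3P[-> _ ->].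
  by move=> ->.
- by rewrite /s' /s -catA perm_cat2l /= perm_cons -(cat_cons x) perm_catC.
- by rewrite /s /s'; case: (s1).
- by rewrite /s /s' !last_cat /= !last_cat.
- move=> u v; rewrite Ls Ls' !mem_cat !inE !mem_cat !inE => /or3P[->//|->//|->].
  by rewrite !orbT.
- by move=> p pc; rewrite Ls' !mem_cat !inE !mem_cat pc !orbT.
- by rewrite Ls' !mem_cat !inE eqxx !orbT.
- by rewrite Ls' !mem_cat !inE !mem_cat !inE eqxx !orbT.
Qed.

(** The link between a and b may be traversed in either direction; for the
    backward one the inserted walk is reversed, which is why e is symmetric. *)
Lemma splice x0 s c a b :
  c != [::] -> sorted e s -> sorted e c -> consecutive s a b ->
  e a (head x0 c) -> e (last x0 c) b ->
  exists s',
  [/\ sorted e s', perm_eq s' (s ++ c),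
      head x0 s' = head x0 s & last x0 s' = last x0 s] /\
  [/\ forall x y, consecutive s x y -> ((x, y) != (a, b)) && ((y, x) != (a, b)) ->
        consecutive s' x y,
      forall x y, consecutive c x y -> consecutive s' x y,
      consecutive s' a (head x0 c) & consecutive s' (last x0 c) b].
Proof.
move=> c0 srt srtc ab eax eyb; case/orP: ab => /links_split[s1 [s2 Es]].
  move: srt; rewrite {}Es => srt.
  have [h1 [h2 h3 h4 h5]] := splice_directed c0 srt srtc eax eyb.
  exists (s1 ++ a :: c ++ b :: s2); split=> //; split.
  - move=> x y /orP[] xy /andP[nxy nyx]; rewrite /consecutive.
      by rewrite (h2 x y).
    by rewrite (h2 y x) // orbT.
  - by move=> x y; exact: sub_consecutive.
  - by rewrite /consecutive h4.
  - by rewrite /consecutive h5.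
move: srt; rewrite {}Es => srt.
have rc0 : rev c != [::] by rewrite -size_eq0 size_rev size_eq0.
have hr z : head z (rev c) = last z c.
  by case/lastP: (c) => // d t; rewrite rev_rcons last_rcons.
have lr z : last z (rev c) = head z c.
  by case: (c) => // t d; rewrite rev_cons last_rcons.
have srtr : sorted e (rev c).
  by rewrite rev_sorted (eq_sorted (e' := e)) // => u v; rewrite e_sym.
have [] := @splice_directed x0 s1 s2 (rev c) b a rc0 srt srtr.
- by rewrite hr e_sym.
- by rewrite lr e_sym.
move=> [p1 p2 p3 p4] [h2 h3 h4 h5].
exists (s1 ++ b :: rev c ++ a :: s2); split.
  by split=> //; rewrite (perm_trans p2) // perm_cat2l perm_rev.
split.
- move=> x y /orP[] xy /andP[nxy nyx]; rewrite /consecutive.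
    by rewrite (h2 x y) //; apply: contra nyx => /eqP[-> ->].
  by rewrite (h2 y x) ?orbT //; apply: contra nxy => /eqP[-> ->].
- by move=> x y; rewrite -[consecutive c _ _]consecutive_rev; apply: sub_consecutive.
- by rewrite consecutiveC -lr /consecutive h5.
- by rewrite consecutiveC -hr /consecutive h4.
Qed.

End Walks.

(** * Hamilton paths of Boolean cubes *)

Section SetWalks.
Variable V : finType.
Implicit Types (A B F H R : {set V}) (D E S : seq {set V}).
Implicit Types (s c : seq {set V}) (a b x y : V).

Definition adjacent A B := #|A :\: B| + #|B :\: A| == 1.

Lemma adjacent_sym : symmetric adjacent.
Proof. by move=> A B; rewrite /adjacent addnC. Qed.

Lemma adjacent_setD1 x A : x \in A -> adjacent A (A :\ x).
Proof.
move=> xA; rewrite /adjacent; have -> : A :\: (A :\ x) = [set x].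
  by apply/setP => y; rewrite !inE; case: eqVneq => [->|_] //=; case: (y \in A).
suff -> : (A :\ x) :\: A = set0 by rewrite cards1 cards0.
by apply/setP => y; rewrite !inE andbC -andbA andbN andbF.
Qed.

Lemma adjacent_sub A F : adjacent A F -> A \subset F ->
  exists2 j, j \in F & A = F :\ j.
Proof.
rewrite /adjacent -setD_eq0 => + /eqP AF; rewrite AF cards0 add0n.
case/cards1P => j E; have: j \in F :\: A by rewrite E inE.
rewrite inE => /andP[jA jF]; exists j => //; apply/setP => y.
have := congr1 (fun X : {set V} => y \in X) E.
have := congr1 (fun X : {set V} => y \in X) AF.
by rewrite !inE; case: (y \in A); case: (y \in F); case: (y == j).
Qed.

(** The invariant carried by the list of boundary ridges, except its first one.
    Each ridge H has an adjacent H :\ y in the walk that only the ridges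
    before it in the list may contain. This acyclicity makes it possible to find
    a place where a new cube can be spliced in. *)
Fixpoint guided s S : Prop :=
  if S is H :: S' then
    (exists y, [/\ y \in H, consecutive s H (H :\ y) &
                   all (fun H' => ~~ (H :\ y \subset H')) S'])
    /\ guided s S'
  else True.

Lemma guided_suffix s S1 S2 : guided s (S1 ++ S2) -> guided s S2.
Proof. by elim: S1 => //= H S1 IH [_ /IH]. Qed.

(** Changing the end of the list, and the walk, only requires to check the
    ridges that are kept against the new end. *)
Lemma guided_replace s s' S S1 S2 :
  guided s (S ++ S1) -> guided s' S2 ->
  (forall H y, H \in S -> y \in H -> consecutive s H (H :\ y) ->
     all (fun H' => ~~ (H :\ y \subset H')) S1 ->
     consecutive s' H (H :\ y) /\ all (fun H' => ~~ (H :\ y \subset H')) S2) ->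
  guided s' (S ++ S2).
Proof.
move=> g g2; elim: S g => //= H S IH [[y [yH cH aH]] /IH{}IH] h.
split; last by apply: IH => K z KS; apply: h; rewrite inE KS orbT.
move: aH; rewrite all_cat => /andP[aS aS1].
have [|c' a'] := h H y _ yH cH aS1; first by rewrite inE eqxx.
by exists y; split; rewrite // all_cat aS.
Qed.

Lemma guided_filter s s' (q : pred {set V}) S :
  guided s S ->
  (forall H y, H \in S -> q H -> y \in H -> consecutive s H (H :\ y) ->
     consecutive s' H (H :\ y)) ->
  guided s' (filter q S).
Proof.
elim: S => //= H S IH [[y [yH cH aH]] /IH{}IH] h.
have {}IH : guided s' (filter q S).
  by apply: IH => K z KS; apply: h; rewrite inE KS orbT.
case: ifP => // qH; split=> //; exists y; split=> //.
  by apply: h; rewrite // inE eqxx.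
by apply/allP => K; rewrite mem_filter => /andP[_]; exact: (allP aH).
Qed.

Definition between R F A := (R \subset A) && (A \subset F).

Lemma first_step R F c :
  sorted adjacent c -> (forall A, A \in c -> between R F A) ->
  head set0 c = F -> last set0 c != F -> c != [::] ->
  exists2 i, i \in F :\: R & consecutive c F (F :\ i).
Proof.
case: c => [|B [|A c]] //=; first by move=> _ _ ->; rewrite eqxx.
case/andP=> adjA _ inc EB _ _; move: adjA inc; rewrite EB => adjA inc.
have /andP[RA AF] : between R F A.
  by apply: inc; rewrite !inE eqxx orbT.
rewrite adjacent_sym in adjA.
have [j jF Ej] := adjacent_sub adjA AF.
exists j; last by rewrite -Ej /consecutive /links /= inE eqxx.
by rewrite inE jF andbT; apply/negP => /(subsetP RA); rewrite Ej !inE eqxx.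
Qed.

(** By induction on the dimension of the cube between R and F: for x0 other
    than b, the half of the cube of sets that contain x0 has a walk from F to
    F :\ b. The other half is inserted in its first link, from F to F :\ j,
    with a walk from F :\ x0 to F :\ x0 :\ j. The inserted walk starts with a
    link from F :\ x0, so x0 can be appended to the list of ridges. *)
Lemma cube_walk R F b : R \subset F -> b \in F :\: R ->
  exists c o,
  [/\ sorted adjacent c, uniq c, forall A, (A \in c) = between R F A,
      head set0 c = F & last set0 c = F :\ b] /\
  [/\ uniq (b :: o), b :: o =i F :\: R &
      guided c [seq F :\ x | x <- o]].
Proof.
have [n] := ubnP #|F :\: R|; elim: n R F b => // n IH R F b cn RF bFR.
have [bF bR] : b \in F /\ b \notin R by move: bFR; rewrite inE => /andP[].
have [E|/set0Pn[x0 x0P]] := eqVneq ((F :\: R) :\ b) set0.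
  have ER : R = F :\ b.
    apply/setP => y; have := congr1 (fun X : {set V} => y \in X) E.
    rewrite !inE; case: eqVneq => [-> _|_] /=; first exact: negbTE.
    by have := subsetP RF y; case: (y \in R); case: (y \in F) => // ->.
  have FbF : F \notin [:: F :\ b].
    by rewrite inE; apply: contraL bF => /eqP->; rewrite !inE eqxx.
  exists [:: F; F :\ b], [::]; split; split=> //.
  - by rewrite /= adjacent_setD1.
  - by rewrite /= FbF.
  - move=> A; rewrite !inE /between ER; apply/orP/andP.
      by move=> [/eqP->|/eqP->]; rewrite ?subsetDl ?subxx.
    case=> lA uA; case bA : (b \in A); [left|right]; rewrite eqEsubset.
      rewrite uA; apply/subsetP => y yF; have [->//|yb] := eqVneq y b.
      by apply: (subsetP lA); rewrite !inE yb.
    rewrite lA andbT; apply/subsetP => y yA; rewrite !inE (subsetP uA _ yA).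
    by rewrite andbT; apply: contraFneq bA => <-.
  - move=> y; rewrite !inE; have := congr1 (fun X : {set V} => y \in X) E.
    rewrite !inE; case: eqVneq => [-> _|_ /= ->] //=.
    by rewrite bR bF.
move: x0P; rewrite !inE => /and3P[x0b x0R x0F].
have up : #|F :\: (x0 |: R)| < n.
  rewrite -ltnS; apply: leq_trans cn; rewrite ltnS; apply: proper_card.
  apply/properP; split; first by rewrite setDS // subsetUr.
  by exists x0; rewrite !inE ?eqxx // x0R.
have low : #|(F :\ x0) :\: R| < n.
  rewrite -ltnS; apply: leq_trans cn; rewrite ltnS; apply: proper_card.
  apply/properP; split; first by rewrite setSD // subsetDl.
  by exists x0; rewrite !inE ?eqxx ?andbF // x0R.
have [||c1 [o1 [[srt1 un1 in1 hd1 ls1] [uo1 io1 g1]]]] := IH (x0 |: R) F b up.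
- by rewrite subUset RF sub1set x0F.
- by rewrite !inE negb_or eq_sym x0b bR.
have c1n0 : c1 != [::] by apply/eqP => c10; have := in1 F; rewrite c10 /between
  subxx subUset sub1set x0F RF.
have [||j jFR cj] := first_step (R := x0 |: R) srt1 _ hd1 _ c1n0.
- by move=> A; rewrite in1.
- by rewrite ls1; apply: contraL bF => /eqP<-; rewrite !inE eqxx.
have [jF jx0 jR] : [/\ j \in F, j != x0 & j \notin R].
  by move: jFR; rewrite !inE negb_or => /andP[/andP[]].
have RF0 : R \subset F :\ x0 by rewrite subsetD1 RF.
have jF0 : j \in (F :\ x0) :\: R by rewrite !inE jR jx0.
have [c2 [o2 [[srt2 un2 in2 hd2 ls2] _]]] := IH R (F :\ x0) j low RF0 jF0.
have c2n0 : c2 != [::].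
  by apply/eqP => c20; have := in2 (F :\ x0); rewrite c20 /between RF0 subxx.
have [||i iF0 ci] := first_step (R := R) srt2 _ hd2 _ c2n0.
- by move=> A; rewrite in2.
- rewrite ls2; apply: contraL jF0 => /eqP E.
  have := congr1 (fun X : {set V} => j \in X) E.
  by rewrite !inE eqxx jx0 jF /=.
have [||c [[srt pe hd ls] [k1 k2 k3 k4]]] :=
    splice (x0 := set0) adjacent_sym c2n0 srt1 srt2 cj.
- by rewrite hd2 adjacent_setD1.
- rewrite ls2 adjacent_sym; have -> : F :\ x0 :\ j = F :\ j :\ x0.
    by apply/setP => y; rewrite !inE andbCA.
  by apply: adjacent_setD1; rewrite !inE eq_sym jx0.
exists c, (rcons o1 x0); split; split=> //.
- rewrite (perm_uniq pe) cat_uniq un1 un2 andbT; apply/hasPn => A.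
  rewrite in2 in1 /between => /andP[_]; rewrite subsetD1 => /andP[_ x0A].
  by apply: contra x0A => /andP[+ _]; rewrite subUset sub1set => /andP[].
- move=> A; rewrite (perm_mem pe) mem_cat in1 in2 /between subUset sub1set.
  rewrite subsetD1; case: (R \subset A); rewrite ?andbF //=.
  by case: (A \subset F); rewrite ?andbF ?andbT // orbN.
- by rewrite hd hd1.
- by rewrite ls ls1.
- rewrite -rcons_cons rcons_uniq uo1 andbT io1 !inE eqxx.
  by [].
- move=> y; rewrite -rcons_cons mem_rcons inE io1 !inE negb_or.
  by case: eqVneq => [->|] //=; rewrite x0R x0F.
rewrite map_rcons -cats1; apply: (guided_replace (s := c1) (S1 := [::])).
- by rewrite cats0.
- split=> //; exists i; split=> //; first by move: iF0; rewrite inE => /andP[].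
  exact: k2.
move=> H y /mapP[x xo1 ->] yF cH _.
have xF : x \in F.
  by have := io1 x; rewrite inE xo1 orbT => /esym; rewrite inE => /andP[].
have := consecutive_mem cH; rewrite !in1 => /andP[_ /andP[]].
rewrite subUset sub1set => /andP[x0in _] _; split.
  have FxF : F :\ x != F.
    by apply: contraL xF => /eqP<-; rewrite !inE eqxx.
  have FxyF : F :\ x :\ y != F.
    by apply: contraL xF => /eqP<-; rewrite !inE eqxx andbF.
  by apply: k1 => //; rewrite !xpair_eqE (negbTE FxF) (negbTE FxyF).
rewrite /= andbT; apply/negP => /subsetP/(_ _ x0in).
by rewrite !inE eqxx.
Qed.

End SetWalks.
Arguments adjacent {V}.

(** * Hamilton paths of shellable complexes *)

Section Shelling.
Variable V : finType.
Implicit Types (A B F H R : {set V}) (D E S : seq {set V}).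
Implicit Types (s c : seq {set V}) (a b x y : V).

Definition faces_of D A := has (fun F => A \subset F) D.

Variable fs : seq {set V}.
Hypothesis fs_uniq : uniq fs.
(** R is the restriction set of the shelling step. The last equation says that
    only the last facet closes the complex up, as in a sphere. *)
Hypothesis shelling : forall D F E, fs = D ++ F :: E ->
  exists R, [/\ R \subset F,
                forall A, A \subset F -> faces_of D A = ~~ (R \subset A) &
                (R == F) = (E == [::])].
(** Purity, in a form that needs no dimension. *)
Hypothesis ridge : forall F F' a, F \in fs -> F' \in fs -> F != F' ->
  a \in F -> F :\ a \subset F' -> exists2 b, b \in F' & F :\ a = F' :\ b.
Hypothesis thin : forall F F1 F2 a, F \in fs -> F1 \in fs -> F2 \in fs ->
  F1 != F -> F2 != F -> a \in F -> F :\ a \subset F1 -> F :\ a \subset F2 ->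
  F1 = F2.

Definition spans s D := [/\ sorted adjacent s, uniq s,
  forall A, (A \in s) = faces_of D A & head set0 s = head set0 fs].

(** The list S has to contain every ridge along which a further facet can be
    glued; it may contain other ridges of the facets in D. *)
Definition boundary D S :=
  (forall H, H \in S -> exists F b, [/\ F \in D, b \in F & H = F :\ b]) /\
  (forall F a, F \in fs -> F \notin D -> a \in F -> faces_of D (F :\ a) ->
     F :\ a \in S).

Definition partial_walk D s S := [/\ spans s D, boundary D S,
  S != [::], last set0 s = head set0 S & guided s (behead S)].

Lemma faces_of_sub D A B : A \subset B -> faces_of D B -> faces_of D A.
Proof.
move=> AB /hasP[F FD BF]; apply/hasP.
by exists F => //; apply: subset_trans BF.
Qed.

Lemma faces_of_rcons D F A : faces_of (rcons D F) A = (A \subset F) || faces_of D A.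
Proof. exact: has_rcons. Qed.

Lemma boundary_faces D S H : boundary D S -> H \in S -> faces_of D H.
Proof.
move=> [h _] /h[F [b [FD _ ->]]].
by apply/hasP; exists F; rewrite // subsetDl.
Qed.

Section Step.
Variables (D E : seq {set V}) (F : {set V}).
Hypothesis fsE : fs = D ++ F :: E.
Variable R : {set V}.
Hypothesis RF : R \subset F.
Hypothesis R_min : forall A, A \subset F -> faces_of D A = ~~ (R \subset A).

Let DF (F' : {set V}) : F' \in D -> (F' \in fs) && (F' != F).
Proof.
move=> F'D; rewrite fsE mem_cat F'D /=; move: fs_uniq; rewrite fsE cat_uniq.
by move=> /and3P[_ /= /norP[+ _] _]; apply: contra => /eqP<-.
Qed.

Let F_fs : F \in fs. Proof. by rewrite fsE mem_cat inE eqxx orbT. Qed.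

Lemma boundary_in_new S a : boundary D S -> a \in R -> F :\ a \in S.
Proof.
move=> [_ h] aR; apply: h => //.
- by apply/negP => /DF; rewrite eqxx andbF.
- exact: (subsetP RF).
- by rewrite R_min ?subsetDl //; apply/negP => /subsetP/(_ _ aR); rewrite !inE eqxx.
Qed.

Lemma boundary_under_new S H : boundary D S -> H \in S -> H \subset F ->
  exists2 a, a \in R & H = F :\ a.
Proof.
move=> bd HS HF; have [F' [b [F'D bF' EH]]] := bd.1 _ HS.
have /andP[F'fs F'F] := DF F'D.
have [|a aF Ea] := ridge F'fs F_fs F'F bF'; first by rewrite -EH.
exists a; last by rewrite EH.
apply/negPn/negP => aR; have := boundary_faces bd HS; rewrite R_min // EH Ea.
by rewrite subsetD1 RF aR.
Qed.

(** If a ridge of a later facet F' was visited before F, it is inside a facet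
    of D, hence not inside F, or it would lie in three facets. *)
Lemma boundary_step S S1 S2 b o : boundary D S -> 
  {subset S1 <= S} -> {subset S2 <= S} ->
  (forall H, H \in S -> ~~ (H \subset F) -> H \in S1 ++ S2) ->
  b :: o =i F :\: R ->
  boundary (rcons D F) (S1 ++ [seq F :\ x | x <- b :: o] ++ S2).
Proof.
move=> bd S1S S2S Ssub io; split=> [H|F' a F'fs].
  rewrite !mem_cat => /or3P[/S1S/bd.1|/mapP[x xo ->]|/S2S/bd.1].
  - by move=> [F' [x [F'D xF' ->]]]; exists F', x; rewrite mem_rcons inE F'D orbT.
  - exists F, x; rewrite mem_rcons inE eqxx; split=> //.
    by move: xo; rewrite io inE => /andP[].
  - by move=> [F' [x [F'D xF' ->]]]; exists F', x; rewrite mem_rcons inE F'D orbT.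
rewrite mem_rcons inE negb_or faces_of_rcons => /andP[F'F F'D] aF'.
case FaD: (faces_of D (F' :\ a)).
  have FaS := bd.2 _ _ F'fs F'D aF' FaD.
  have [/hasP[F1 F1D F1a] _] := (FaD, I).
  have /andP[F1fs F1F] := DF F1D.
  have nF : ~~ (F' :\ a \subset F).
    apply/negP => FaF; move: F1F; rewrite (@thin F' F1 F a) ?eqxx // 1?eq_sym //.
    by apply: contraNneq F'D => ->.
  by have := Ssub _ FaS nF; rewrite !mem_cat => /orP[]->; rewrite ?orbT.
rewrite orbF => FaF; have [x xF Ex] := ridge F'fs F_fs F'F aF' FaF.
rewrite !mem_cat; apply/orP; right; apply/orP; left; apply/mapP; exists x => //.
rewrite io inE xF andbT; have := FaD; rewrite R_min // => /negbFE.
by rewrite Ex subsetD1 => /andP[].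
Qed.

(** A new ridge minus a vertex, if it is in the new cube, contains R and is
    thus in no old face; the old ridges at the end of the list are harmless. *)
Lemma guided_new s' S2 c (o : seq V) :
  (forall A, A \in c -> between R F A) ->
  (forall A B, consecutive c A B -> consecutive s' A B) ->
  guided c [seq F :\ x | x <- o] -> 
  (forall H, H \in S2 -> faces_of D H) ->
  guided s' S2 -> guided s' ([seq F :\ x | x <- o] ++ S2).
Proof.
move=> inc cs' gc S2D gS2; apply: (guided_replace (s := c) (S1 := [::])) => //.
  by rewrite cats0.
move=> H y _ yH cH _; split; first exact: cs'.
apply/allP => H' /S2D; have /andP[_ /inc/andP[RHy HyF]] := consecutive_mem cH.
by move=> H'D; apply/negP => /faces_of_sub/(_ H'D); rewrite R_min // RHy.
Qed.

Lemma first_under S : boundary D S -> R != set0 ->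
  exists a S1 S2, [/\ a \in R, S = S1 ++ F :\ a :: S2 &
                      all (fun H => ~~ (H \subset F)) S1].
Proof.
move=> bd /set0Pn[a0 a0R]; pose p := [pred H : {set V} | H \subset F].
have hp : has p S.
  by apply/hasP; exists (F :\ a0); rewrite ?boundary_in_new //= subsetDl.
have iS : find p S < size S by rewrite -has_find.
have [|a aR Ea] := boundary_under_new bd (mem_nth set0 iS).
  exact: (nth_find set0 hp).
exists a, (take (find p S) S), (drop (find p S).+1 S); split=> //.
  by rewrite -Ea -drop_nth // cat_take_drop.
apply/(all_nthP set0) => i; rewrite size_take iS => ilt.
by rewrite nth_take // -[_ \subset _]/(p _) before_find.
Qed.

(** If y were in R, then F :\ y would be on the boundary and inside F, hence
    listed after F :\ a, although it contains F :\ a :\ y. *)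
Lemma partner_out S1 S2 s a : boundary D (S1 ++ F :\ a :: S2) ->
  all (fun H => ~~ (H \subset F)) S1 -> a \in R ->
  guided s (F :\ a :: S2) ->
  exists y, [/\ y \in F :\: R, y != a, consecutive s (F :\ a) (F :\ a :\ y) &
              all (fun H' => ~~ (F :\ a :\ y \subset H')) S2].
Proof.
move=> bd aS1 aR [[y [yFa cy ay]] _]; exists y.
have [ya yF] : y != a /\ y \in F by move: yFa; rewrite !inE => /andP[].
split=> //; rewrite inE yF andbT; apply/negP => yR.
have := boundary_in_new bd yR; rewrite mem_cat inE => /or3P[FyS1|/eqP E1|FyS2].
- by move/allP: aS1 => /(_ _ FyS1); rewrite subsetDl.
- by have := congr1 (fun X : {set V} => y \in X) E1; rewrite !inE eqxx ya yF.
- move/allP: ay => /(_ _ FyS2) /negP; apply.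
  by apply/subsetP => z; rewrite !inE => /and3P[-> _ ->].
Qed.

(** The new ridges take the place of F :\ a in the list, and the other ridges
    inside F disappear. A ridge H before that place remains guided: if
    H :\ y were inside a new ridge, then, not being new, it would miss an
    element z of R and be inside F :\ z, which is listed after H. *)
Lemma partial_walk_step s S : R != set0 -> R != F -> partial_walk D s S ->
  exists s' S', partial_walk (rcons D F) s' S'.
Proof.
move=> R0 RnF [[srt un ins hd] bd Sn0 ls g].
have [a [S1 [S2 [aR ES aS1]]]] := first_under bd R0.
have aF : a \in F := subsetP RF _ aR.
pose q := [pred H : {set V} | ~~ (H \subset F)].
have SD H : H \in S -> faces_of D H := boundary_faces bd.
have S2S : {subset S2 <= S} by move=> H HS; rewrite ES mem_cat inE HS !orbT.
have S1S : {subset S1 <= S} by move=> H HS; rewrite ES mem_cat HS.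
have fS2S : {subset filter q S2 <= S}.
  by move=> H; rewrite mem_filter => /andP[_ /S2S].
have keep H : H \in S -> ~~ (H \subset F) -> H \in S1 ++ filter q S2.
  rewrite ES !mem_cat mem_filter inE /= => /or3P[->//|/eqP->|->].
    by rewrite subsetDl.
  by move=> ->; rewrite orbT.
have s_new A : A \in s -> ~~ between R F A.
  rewrite ins => AD; apply/negP => /andP[RA AF].
  by move: AD; rewrite R_min // RA.
have new_ins s' c : perm_eq s' (s ++ c) -> uniq c ->
    (forall A, (A \in c) = between R F A) ->
    uniq s' /\ forall A, (A \in s') = faces_of (rcons D F) A.
  move=> pe unc inc; split.
    rewrite (perm_uniq pe) cat_uniq un unc andbT /=; apply/hasPn => A.
    by rewrite inc; apply: contraL => /s_new.
  move=> A; rewrite (perm_mem pe) mem_cat inc ins faces_of_rcons /between.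
  case AF: (A \subset F); last by rewrite andbF orbF.
  by rewrite andbT R_min //; case: (_ \subset _).
have sn0 : s != [::].
  apply/eqP => s0; have := SD _ (boundary_in_new bd aR).
  by rewrite -ins s0.
case: S1 => [|H0 S1] in ES aS1 S1S keep.
  (* F :\ a is the end of the walk, which any walk of the new cube prolongs. *)
  have [b bT] : exists b, b \in F :\: R.
    apply/set0Pn; rewrite setD_eq0; apply: contra RnF => FR.
    by rewrite eqEsubset RF.
  have [c [o [[srtc unc inc hdc lsc] [uo io gc]]]] := cube_walk RF bT.
  have cn0 : c != [::].
    by apply/eqP => c0; have := inc F; rewrite c0 /between RF subxx.
  have pe : perm_eq (s ++ c) (s ++ c) by [].
  have [un' in'] := new_ins _ _ pe unc inc.
  exists (s ++ c), ([seq F :\ x | x <- b :: o] ++ filter q S2); split=> //.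
  - split=> //; last by case: (s) sn0 hd.
    apply: (sorted_cat (x0 := set0)) => //.
    by rewrite ls hdc ES adjacent_sym adjacent_setD1.
  - exact: (boundary_step (S := S) (S1 := [::])).
  - by rewrite last_cat; case: (c) cn0 lsc.
  - apply: (guided_new (c := c)) => //.
    + by move=> A; rewrite inc.
    + by move=> A B; apply: sub_consecutive; exact: links_suffix.
    + by move=> H /fS2S/SD.
    + apply: (guided_filter (s := s)); first by move: g; rewrite ES.
      by move=> H y _ _ _; apply: sub_consecutive; exact: links_prefix.
(* F :\ a is inside the walk, and the new cube goes in between F :\ a and its
   partner F :\ a :\ b. *)
have g' : guided s (F :\ a :: S2).
  by move: g; rewrite ES; exact: guided_suffix.
have bd' : boundary D ((H0 :: S1) ++ F :\ a :: S2) by rewrite -ES.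
have [b [bT ba cb ab]] := partner_out bd' aS1 aR g'.
have [bF bR] : b \in F /\ b \notin R by move: bT; rewrite inE => /andP[].
have [c [o [[srtc unc inc hdc lsc] [uo io gc]]]] := cube_walk RF bT.
have cn0 : c != [::].
  by apply/eqP => c0; have := inc F; rewrite c0 /between RF subxx.
have Fab : F :\ a :\ b = F :\ b :\ a.
  by apply/setP => z; rewrite !inE andbCA.
have [||s' [[srt' pe hd' ls'] [k1 k2 k3 k4]]] :=
    splice (x0 := set0) (@adjacent_sym V) cn0 srt srtc cb.
- by rewrite hdc adjacent_sym adjacent_setD1.
- by rewrite lsc Fab; apply: adjacent_setD1; rewrite !inE eq_sym ba aF.
have [un' in'] := new_ins _ _ pe unc inc.
have k1' H y : ~~ (H \subset F) -> consecutive s H (H :\ y) ->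
    consecutive s' H (H :\ y).
  move=> HF cH; apply: k1 => //; rewrite !xpair_eqE !negb_and.
  have n1 : H != F :\ a by apply: contraNneq HF => ->; rewrite subsetDl.
  have n2 : H != F :\ a :\ b.
    by apply: contraNneq HF => ->; rewrite !(subset_trans (subsetDl _ _)) ?subsetDl.
  by rewrite n1 n2 orbT.
exists s', ((H0 :: S1) ++ [seq F :\ x | x <- b :: o] ++ filter q S2); split=> //.
- by split; rewrite // hd'.
- by apply: (boundary_step (S := S)).
- by rewrite ls' ls ES.
rewrite /= ES /= in g *; apply: (guided_replace g).
  split.
    exists a; split; first by rewrite !inE eq_sym ba.
      by rewrite -Fab -lsc.
    rewrite all_cat; apply/andP; split.
      apply/allP => _ /mapP[x xo ->]; apply/negP => /subsetP/(_ x).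
      have xT : x \in F :\: R by rewrite -io inE xo orbT.
      have xb : x != b.
        by apply: contraTneq xo => ->; move: uo => /= /andP[].
      move: xT; rewrite !inE eqxx xb => /andP[xR xF]; rewrite xF andbT /=.
      by have -> : x != a by [apply: contraNneq xR => ->]; move=> /(_ isT).
    apply/allP => H; rewrite mem_filter => /andP[_ /(allP ab)].
    by rewrite Fab.
  apply: (guided_new (c := c)) => //.
  - by move=> A; rewrite inc.
  - by move=> H /fS2S/SD.
  - apply: (guided_filter (s := s)); first by case: g'.
    by move=> H y _ HF _; exact: k1'.
move=> H y HS yH cH aH.
have HF : ~~ (H \subset F) by move/allP: aS1; apply; rewrite inE HS orbT.
split; first exact: k1'.
have aHR z : z \in R -> ~~ (H :\ y \subset F :\ z).
  move=> zR; have := boundary_in_new bd zR; rewrite ES mem_cat => /orP[].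
    by move=> /(allP aS1); rewrite subsetDl.
  exact: (allP aH).
have HyD : faces_of D (H :\ y).
  by rewrite -ins; have /andP[] := consecutive_mem cH.
have HyF : ~~ (H :\ y \subset F).
  apply/negP => HyF; move: HyD; rewrite R_min // => /subsetPn[z zR zH].
  by have := aHR z zR; rewrite subsetD1 HyF zH.
rewrite -cat_cons all_cat; apply/andP; split.
  rewrite -[X in all _ X]/[seq F :\ x | x <- b :: o]; apply/allP => _ /mapP[x _ ->].
  by apply: contra HyF => sub; apply: subset_trans sub (subsetDl _ _).
apply/allP => K; rewrite mem_filter => /andP[_ KS2].
by apply: (allP aH); rewrite inE KS2 orbT.
Qed.
End Step.

(** For the first facet the restriction set is empty, since the empty face is
    new, and the whole cube of its subsets is walked. *)
Lemma partial_walk_start F E : fs = F :: E -> E != [::] ->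
  exists s S, partial_walk [:: F] s S.
Proof.
move=> fsE En0; have [R [RF R_min RE]] := @shelling [::] F E fsE.
have R0 : R = set0.
  by have := R_min set0 (sub0set F); rewrite subset0 => /esym/negbFE/eqP.
have [b bT] : exists b, b \in F :\: R.
  by apply/set0Pn; rewrite R0 setD0 -R0 eq_sym RE.
have [c [o [[srt un inc hd ls] [uo io g]]]] := cube_walk RF bT.
exists c, [seq F :\ x | x <- b :: o]; split=> //.
  split=> //; last by rewrite fsE.
  by move=> A; rewrite inc /between R0 sub0set /= orbF.
have bd0 : boundary [::] [::] by [].
have := @boundary_step [::] E F fsE R R_min [::] [::] [::] b o bd0.
by rewrite /= cats0; apply.
Qed.

Lemma partial_walk_exists D E : fs = D ++ E -> D != [::] -> E != [::] ->
  exists s S, partial_walk D s S.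
Proof.
elim/last_ind: D E => [|D F IH] E //; rewrite cat_rcons => fsE _ En0.
have [D0|Dn0] := eqVneq D [::].
  by rewrite D0 /= in fsE *; apply: (partial_walk_start fsE).
have [s [S pw]] := IH (F :: E) fsE Dn0 isT.
have [R [RF R_min RE]] := shelling fsE.
apply: (partial_walk_step fsE RF R_min _ _ pw); last by rewrite RE.
apply/eqP => R0; have := R_min set0 (sub0set _); rewrite R0 sub0set /=.
by case: (D) Dn0 => //= F' D' _; rewrite sub0set.
Qed.

(** For the last facet G all proper subsets are already visited, so [partner_out]
    is contradictory unless the walk ends at a ridge of G. *)
Theorem shelling_walk : 1 < size fs ->
  exists s, [/\ sorted adjacent s, uniq s, forall A, (A \in s) = faces_of fs A,
                head set0 s = head set0 fs & last set0 s = last set0 fs].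
Proof.
move=> szfs; have [D [G Efs]] : exists D G, fs = rcons D G.
  by case: (lastP fs) szfs => // D G _; exists D, G.
have Dn0 : D != [::] by move: szfs; rewrite Efs size_rcons ltnS; case: (D).
have fsE : fs = D ++ [:: G] by rewrite Efs cats1.
have [s [S pw]] := partial_walk_exists fsE Dn0 isT.
have [[srt un ins hd] bd Sn0 ls g] := pw.
have [R [RG R_min RE]] := shelling fsE; rewrite eqxx in RE.
have {RE}RE : R = G by apply/eqP.
have DG A : A \subset G -> faces_of D A = (A != G).
  by move=> AG; rewrite R_min // RE eqEsubset AG.
have R0 : R != set0.
  apply/eqP => R0; have := R_min set0 (sub0set _); rewrite R0 sub0set /=.
  by case: (D) Dn0 => //= F' D' _; rewrite sub0set.
have [a [S1 [S2 [aR ES aS1]]]] := first_under fsE RG R_min bd R0.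
case: S1 => [|H0 S1] in ES aS1; last first.
  have g' : guided s (G :\ a :: S2).
    by move: g; rewrite ES; exact: guided_suffix.
  have bd' : boundary D ((H0 :: S1) ++ G :\ a :: S2) by rewrite -ES.
  have [y [+ _ _ _]] := partner_out fsE RG R_min bd' aS1 aR g'.
  by rewrite RE setDv inE.
have aG : a \in G by rewrite -RE.
have sn0 : s != [::].
  apply/eqP => s0; have := ins set0; rewrite s0 DG ?sub0set //=.
  by move/esym/negbFE/eqP => G0; rewrite -G0 inE in aG.
exists (s ++ [:: G]); split.
- apply: (sorted_cat (x0 := set0)) => //=.
  by rewrite ls ES adjacent_sym adjacent_setD1.
- by rewrite cat_uniq un /= orbF ins DG // eqxx.
- move=> A; rewrite mem_cat inE ins fsE /faces_of has_cat /= orbF.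
  case AG: (A \subset G); last first.
    have -> : (A == G) = false by apply: contraFF AG => /eqP->.
    by rewrite !orbF.
  by rewrite orbT -/(faces_of D A) DG //; case: eqP.
- by rewrite -hd; case: (s) sn0.
- by rewrite fsE !last_cat.
Qed.

End Shelling.

(** * Facet functions and their neighbours *)

Section FacetFunctions.
Local Open Scope ring_scope.
Variables (R : realFieldType) (I : finType) (U : (I -> R) -> Prop).
Hypothesis U_lin : forall (a b : R) f g, U f -> U g ->
  U (fun i => a * f i + b * g i).
Implicit Types (f g h k : I -> R) (A B X : {set I}) (i x y v : I).

Definition zeros f : {set I} := [set i | f i == 0].

Lemma in_zeros f i : (i \in zeros f) = (f i == 0).
Proof. by rewrite inE. Qed.

(** The points are indexed by I, and U stands for the space of the affine
    functions restricted to them. Being determined by its zeros up to a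
    scalar is what makes a face of codimension one. *)
Definition facet_fun g := [/\ U g, forall i, 0 <= g i, exists i, g i != 0 &
  forall h, U h -> (forall i, i \in zeros g -> h i = 0) ->
    exists l, forall i, h i = l * g i].

(** The zeros of a facet function are affinely independent: this is where
    simpliciality enters. *)
Hypothesis coords : forall g a, facet_fun g -> a \in zeros g ->
  exists h, [/\ U h, h a = 1 & forall i, i \in zeros g -> i != a -> h i = 0].

Lemma facet_fun_maximal g h : facet_fun g -> U h -> (exists i, h i != 0) ->
  zeros g \subset zeros h -> zeros h = zeros g.
Proof.
move=> [_ _ _ fg] Uh [j hj] /subsetP gh.
have [|l hl] := fg h Uh; first by move=> i /gh; rewrite in_zeros => /eqP.
have l0 : l != 0 by apply: contraNneq hj => l0; rewrite hl l0 mul0r.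
by apply/setP => i; rewrite !in_zeros hl mulf_eq0 (negbTE l0).
Qed.

(** The smallest l for which l * g + h is nonnegative: it is reached at a point
    v where the ratio of - h to g is maximal. *)
Lemma pivot g h : (forall i, 0 <= g i) -> (exists i, g i != 0) ->
  (forall i, i \in zeros g -> 0 <= h i) ->
  exists l v, [/\ v \notin zeros g, l * g v + h v = 0 &
                  forall i, 0 <= l * g i + h i].
Proof.
move=> g0 [i0 gi0] h0.
have P0 : i0 \notin zeros g by rewrite in_zeros.
have [v vz vmax] :=
  @arg_maxP _ R I i0 (fun i => i \notin zeros g) (fun i => - h i / g i) P0.
have gv : g v != 0 by rewrite -in_zeros.
exists (- h v / g v), v; split=> //; first by rewrite divfK // addNr.
move=> i; have [iz|iz] := boolP (i \in zeros g).
  have gi : g i = 0 by move: iz; rewrite in_zeros => /eqP.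
  by rewrite gi mulr0 add0r h0.
have gi : 0 < g i by rewrite lt_neqAle g0 eq_sym -in_zeros iz.
by rewrite -lerBlDr sub0r -ler_pdivrMr //; exact: vmax.
Qed.

(** If g is not a facet function, some h vanishes on its zeros without being
    a multiple of g, and pivoting g with h enlarges the set of zeros. *)
Lemma under_facet g : U g -> (forall i, 0 <= g i) -> (exists i, g i != 0) ->
  exists g', facet_fun g' /\ zeros g \subset zeros g'.
Proof.
have [n] := ubnP #|~: zeros g|; elim: n g => // n IH g cn Ug g0 gn0.
have [fg|nfg] := pselect (facet_fun g); first by exists g.
have [h [Uh hz hn]] : exists h, [/\ U h, forall i, i \in zeros g -> h i = 0 &
    ~ exists l, forall i, h i = l * g i].
  apply: contrapT => H; apply: nfg; split=> // h Uh hz.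
  by apply: contrapT => hn; apply: H; exists h.
have [|l [v [vz v0 pos]]] := @pivot g h g0 gn0; first by move=> i /hz->.
pose g1 i := l * g i + 1 * h i.
have g1E i : g1 i = l * g i + h i by rewrite /g1 mul1r.
have sub : zeros g \subset zeros g1.
  apply/subsetP => i iz; rewrite in_zeros g1E (hz i iz) addr0.
  by move: iz; rewrite in_zeros => /eqP->; rewrite mulr0.
have [|||g' [fg' sg']] := IH g1 _ (U_lin l 1 Ug Uh).
- rewrite -ltnS; apply: leq_trans cn; rewrite ltnS; apply: proper_card.
  apply/properP; split; first by rewrite setCS.
  by exists v; rewrite !inE ?g1E ?v0 ?eqxx // -in_zeros.
- by move=> i; rewrite -/(g1 i) g1E.
- apply: contrapT => H; apply: hn; exists (- l) => i.
  apply/eqP; rewrite mulNr -addr_eq0 addrC -g1E; apply/negPn/negP => ni.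
  by apply: H; exists i.
by exists g'; split=> //; apply: subset_trans sg'.
Qed.

(** The functions of U that vanish on zeros g :\ a are the combinations of g and
    of the coordinate function h of a. The nonnegative ones form a cone in this
    plane: g spans one side of it, and the pivot of g with h the other. *)
Lemma facet_fun_neighbor g a : facet_fun g -> a \in zeros g ->
  exists g' v, [/\ facet_fun g', v \notin zeros g,
    zeros g' = v |: (zeros g :\ a) &
    forall g2, facet_fun g2 -> zeros g :\ a \subset zeros g2 ->
      zeros g2 != zeros g -> zeros g2 = zeros g'].
Proof.
move=> fg az; have [Ug g0 gn0 gP] := fg.
have [h [Uh ha hz]] := coords fg az.
have ga : g a = 0 by move: az; rewrite in_zeros => /eqP.
have [|l [v [vz v0 pos]]] := @pivot g h g0 gn0.
  by move=> i iz; have [->|ia] := eqVneq i a; rewrite ?ha // hz.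
have gv : g v != 0 by rewrite -in_zeros.
pose g1 i := l * g i + 1 * h i.
have g1E i : g1 i = l * g i + h i by rewrite /g1 mul1r.
have g1a : g1 a = 1 by rewrite g1E ga mulr0 add0r.
have Ug1 : U g1 by exact: U_lin.
have key k : U k -> (forall i, i \in zeros g :\ a -> k i = 0) ->
    exists m, forall i, k i = m * g i + k a * h i.
  move=> Uk kz.
  have [|m hm] := gP _ (U_lin 1 (- k a) Uk Uh).
    move=> i iz; have [->|ia] := eqVneq i a; first by rewrite ha; ring.
    by rewrite hz // kz ?inE ?ia //; [ring | move: iz; rewrite in_zeros].
  by exists m => i; rewrite -hm; ring.
have key2 k : U k -> (forall i, i \in zeros g :\ a -> k i = 0) -> k v = 0 ->
    forall i, k i = k a * g1 i.
  move=> Uk kz kv; have [m hm] := key k Uk kz.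
  have hv : h v = - (l * g v) by apply/eqP; rewrite -addr_eq0 addrC v0.
  have E : (m - k a * l) * g v = 0 by rewrite -kv (hm v) hv; ring.
  have {}E : m = k a * l.
    by apply/eqP; move/eqP: E; rewrite mulf_eq0 (negbTE gv) orbF subr_eq0.
  by move=> i; rewrite {1}hm g1E E; ring.
have sub : v |: (zeros g :\ a) \subset zeros g1.
  apply/subsetP => i; rewrite in_setU1 in_zeros g1E => /predU1P[->|].
    by rewrite v0.
  rewrite !inE => /andP[ia iz]; rewrite hz ?in_zeros // (eqP iz).
  by rewrite mulr0 addr0.
have sub1 k : (forall i, i \in zeros g1 -> k i = 0) ->
    (forall i, i \in zeros g :\ a -> k i = 0) /\ k v = 0.
  move=> kz; split=> [i iz|]; apply: kz; apply: (subsetP sub).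
    by rewrite in_setU1 iz orbT.
  by rewrite setU11.
have fg1 : facet_fun g1.
  split=> //.
  - by move=> i; rewrite g1E.
  - by exists a; rewrite g1a oner_eq0.
  - move=> k Uk /sub1[kz kv]; exists (k a); exact: key2.
have z1 : zeros g1 = v |: (zeros g :\ a).
  apply/eqP; rewrite eqEsubset sub andbT; apply/subsetP => i iz1.
  apply/negPn/negP; rewrite in_setU1 negb_or => /andP[iv iza].
  have [k [Uk ki kz]] := coords fg1 iz1.
  have kE : k i = k a * g1 i.
    apply: key2 => // [j jz|]; apply: kz.
    - by apply: (subsetP sub); rewrite in_setU1 jz orbT.
    - by apply: contraNneq iza => <-.
    - by apply: (subsetP sub); rewrite setU11.
    - by rewrite eq_sym.
  move: iz1 kE; rewrite in_zeros ki => /eqP->; rewrite mulr0 => /eqP.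
  by rewrite oner_eq0.
exists g1, v; split=> // g2 fg2 /subsetP sub2 nz2.
have [Ug2 g20 g2n0 g2P] := fg2.
have [|m hm] := key g2 Ug2; first by move=> i /sub2; rewrite in_zeros => /eqP.
have c0 : 0 < g2 a.
  rewrite lt_neqAle g20 andbT eq_sym; apply: contra nz2 => /eqP c0.
  rewrite (facet_fun_maximal fg Ug2 g2n0) //.
  apply/subsetP => i; rewrite !in_zeros hm c0 mul0r addr0 => /eqP->.
  by rewrite mulr0.
pose d := m - g2 a * l.
have g2E i : g2 i = d * g i + g2 a * g1 i by rewrite {1}hm g1E /d; ring.
have g1v : g1 v = 0 by rewrite g1E.
have gvp : 0 < g v by rewrite lt_neqAle g0 eq_sym gv.
have : 0 <= d.
  by have := g20 v; rewrite g2E g1v mulr0 addr0 pmulr_lge0.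
rewrite le_eqVlt => /predU1P[d0|dp].
  apply/setP => i; rewrite !in_zeros g2E -d0 mul0r add0r mulf_eq0.
  by rewrite (gt_eqF c0).
have [|n hn] := g2P _ Ug1.
  move=> i; rewrite in_zeros g2E => /eqP E.
  have e1 : 0 <= d * g i by rewrite mulr_ge0 // ltW.
  have e2 : 0 <= g2 a * g1 i by apply: mulr_ge0; [exact: ltW | rewrite g1E].
  have /eqP : g2 a * g1 i = 0 by lra.
  by rewrite mulf_eq0 (gt_eqF c0) => /eqP.
have g2v : 0 < g2 v by rewrite g2E g1v mulr0 addr0 mulr_gt0.
have n0 : n = 0.
  apply/eqP; have := hn v; rewrite g1v => /esym/eqP.
  by rewrite mulf_eq0 (gt_eqF g2v) orbF.
by have := hn a; rewrite n0 mul0r g1a => /eqP; rewrite oner_eq0.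
Qed.

Lemma U_sum (J : finType) (P : pred J) (m : J -> R) (q : J -> I -> R) f :
  U f -> (forall j, P j -> U (q j)) ->
  U (fun i => f i - \sum_(j | P j) m j * q j i).
Proof.
move=> Uf Uq; rewrite -[X in U X]/(fun i => _).
suff H (s : seq J) : U (fun i => f i - \sum_(j <- s | P j) m j * q j i).
  exact: H.
elim: s => [|j s IH].
  by have := U_lin 1 0 Uf Uf; congr U; apply/funext => i; rewrite big_nil; ring.
have [Pj|Pj] := boolP (P j); last first.
  by move: IH; congr U; apply/funext => i; rewrite big_cons (negbTE Pj).
have := U_lin 1 (- m j) IH (Uq j Pj); congr U; apply/funext => i.
by rewrite big_cons Pj; ring.
Qed.

(** The sum of the coordinate functions of the zeros to be removed, made positive
    away from zeros g by a multiple of g. *)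
Lemma subface g B : facet_fun g -> B \subset zeros g ->
  exists f, [/\ U f, forall i, 0 <= f i & zeros f = B].
Proof.
move=> fg /subsetP Bz; have [Ug g0 gn0 _] := fg.
have /choice[h hP] : forall a, exists h, a \in zeros g ->
    [/\ U h, h a = 1 & forall i, i \in zeros g -> i != a -> h i = 0].
  move=> a; have [az|_] := boolP (a \in zeros g); last by exists (fun=> 0).
  by have [h hP] := coords fg az; exists h.
pose q i := g i - \sum_(a in zeros g :\: B) -1 * h a i.
have Uq : U q by apply: U_sum => // a /setDP[/hP[]].
have qz i : i \in zeros g -> q i = (i \notin B)%:R.
  move=> iz; have /eqP gi : g i == 0 by rewrite -in_zeros.
  have off a : a \in zeros g :\: B -> a != i -> -1 * h a i = 0.
    by move=> /setDP[/hP[_ _ hz] _] ai; rewrite hz ?mulr0 // eq_sym.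
  rewrite /q gi; have [iB|iB] := boolP (i \in B).
    rewrite big1 ?subr0 // => a aP; rewrite off //.
    by apply: contraTneq aP => ->; rewrite inE iB.
  have iP : i \in zeros g :\: B by rewrite in_setD iB.
  rewrite (bigD1 i) //= big1 => [|a /andP[]]; last exact: off.
  by have [_ -> _] := hP i iz; rewrite mulr1 addr0 sub0r opprK.
have [|l [v [_ _ pos]]] := @pivot g q g0 gn0.
  by move=> i iz; rewrite qz.
exists (fun i => (l + 1) * g i + 1 * q i).
have fE i : (l + 1) * g i + 1 * q i = (l * g i + q i) + g i by ring.
split; first exact: U_lin.
  by move=> i; rewrite fE addr_ge0.
apply/setP => i; rewrite in_zeros fE; have [iz|iz] := boolP (i \in zeros g).
  have /eqP gi : g i == 0 by rewrite -in_zeros.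
  by rewrite qz // gi mulr0 add0r addr0 pnatr_eq0 eqb0 negbK.
have gi : 0 < g i by rewrite lt_neqAle g0 eq_sym -in_zeros iz.
by rewrite gt_eqF ?ltr_wpDl //; apply/esym/negP => /Bz; apply/negP.
Qed.

(** The function gB minus a suitable combination of the functions q x, with
    nonnegative coefficients, vanishes on zeros gA, so that it is a multiple
    of gA. The sums with weights p then compare as claimed; p is the
    objective of a linear program for which gA is a strict local minimum. *)
Lemma facet_local_min (p : I -> R) gA gB X (q : I -> I -> R) :
  facet_fun gA -> facet_fun gB -> X \subset zeros gA -> X \subset zeros gB ->
  zeros gB != zeros gA -> \sum_i p i * gA i = 0 ->
  (forall x, x \in zeros gA :\: X -> [/\ facet_fun (q x),
     zeros gA :\ x \subset zeros (q x), zeros (q x) != zeros gA &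
     0 < \sum_i p i * q x i]) ->
  0 < \sum_i p i * gB i.
Proof.
move=> fA fB XA XB nBA pA hq.
have [UB B0 Bn0 _] := fB; have [_ _ _ AP] := fA.
have qx x : x \in zeros gA :\: X -> 0 < q x x.
  move=> xz; have [[Uq q0 qn0 _] sq nq _] := hq x xz.
  rewrite lt_neqAle q0 andbT eq_sym; apply: contra nq => qxx.
  rewrite (facet_fun_maximal fA Uq qn0) //; apply/subsetP => i iz.
  have [->|ix] := eqVneq i x; first by rewrite in_zeros.
  by apply: (subsetP sq); rewrite in_setD1 ix.
pose m x := gB x / q x x.
have Ur : U (fun i => gB i - \sum_(x in zeros gA :\: X) m x * q x i).
  by apply: U_sum => // x /hq[[]].
have [|l hl] := AP _ Ur.
  move=> y yz; have offd x : x \in zeros gA :\: X -> x != y -> q x y = 0.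
    move=> /hq[_ /subsetP sq _ _] xy; apply/eqP; rewrite -in_zeros; apply: sq.
    by rewrite in_setD1 eq_sym xy.
  have [yX|yX] := boolP (y \in X).
    have /eqP -> : gB y == 0 by rewrite -in_zeros (subsetP XB).
    rewrite big1 ?subr0 // => x xz; rewrite offd ?mulr0 //.
    by apply: contraTneq xz => ->; rewrite inE yX.
  have yP : y \in zeros gA :\: X by rewrite inE yX.
  rewrite (bigD1 y) //= big1 ?addr0 => [|x /andP[xz xy]].
    by rewrite /m divfK ?subrr // gt_eqF ?qx.
  by rewrite offd ?mulr0.
have BE i : gB i = l * gA i + \sum_(x in zeros gA :\: X) m x * q x i.
  by rewrite -hl; ring.
have m0 x : x \in zeros gA :\: X -> 0 <= m x.
  by move=> xz; rewrite divr_ge0 // ltW // qx.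
have E : \sum_i p i * gB i = \sum_(x in zeros gA :\: X) m x * \sum_i p i * q x i.
  under eq_bigr do rewrite BE mulrDr mulrCA mulr_sumr.
  rewrite big_split /= -mulr_sumr pA mulr0 add0r exchange_big /=.
  by apply: eq_bigr => x _; rewrite mulr_sumr; apply: eq_bigr => i _; ring.
have ge x : x \in zeros gA :\: X -> 0 <= m x * \sum_i p i * q x i.
  by move=> xz; rewrite mulr_ge0 ?m0 // ltW //; have [] := hq x xz.
rewrite E lt_neqAle sumr_ge0 // andbT eq_sym psumr_eq0 //.
apply: contra nBA => /allP H; rewrite (facet_fun_maximal fA UB) //.
apply/subsetP => i; rewrite !in_zeros BE => /eqP->; rewrite mulr0 add0r.
rewrite big1 // => x xz; have := H x (mem_index_enum _); rewrite xz /=.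
have [_ _ _ pq] := hq x xz.
by rewrite mulf_eq0 (gt_eqF pq) orbF => /eqP->; rewrite mul0r.
Qed.

(** * Sweeping the facets along a generic line *)

(** Weights along a moment curve: each sum is a nonzero polynomial in the
    parameter t, and some positive integer t is a root of none of them. *)
Lemma generic_weights (J : finType) (P : pred J) (F : {set I})
    (c : J -> I -> R) :
  (forall j, P j -> exists2 i, i \in F & c j i != 0) ->
  exists s : I -> R, [/\ forall i, i \in F -> 0 < s i,
    forall i, i \notin F -> s i = 0 &
    forall j, P j -> \sum_i s i * c j i != 0].
Proof.
move=> hc; pose p j : {poly R} := \sum_(i in F) c j i *: 'X^(enum_rank i).
have p0 j : P j -> p j != 0.
  move=> /hc[i0 i0F]; apply: contraNneq => pj0.
  have := coef0 R (enum_rank i0); rewrite -pj0 coef_sum (bigD1 i0) //= big1.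
    by rewrite coefZ coefXn eqxx mulr1 addr0 => ->.
  move=> i /andP[_ ii0]; rewrite coefZ coefXn; case: eqP => [E|_].
    by move: ii0; rewrite -(inj_eq enum_rank_inj) -val_eqE /= E eqxx.
  by rewrite mulr0.
pose q := \prod_(j | P j) p j.
have q0 : q != 0 by apply/prodf_neq0 => j; exact: p0.
pose rs : seq R := [seq n.+1%:R | n <- iota 0 (size q)].
have [t trs qt] : exists2 t, t \in rs & ~~ root q t.
  apply/allPn/negP => al; have := max_poly_roots q0 al.
  rewrite size_map size_iota ltnn => /(_ _)/negP; apply => //.
  rewrite map_inj_uniq ?iota_uniq // => i j /eqP.
  by rewrite eqr_nat => /eqP[].
have t0 : 0 < t by case/mapP: trs => k _ ->; rewrite ltr0n.
exists (fun i => if i \in F then t ^+ enum_rank i else 0); split.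
- by move=> i ->; rewrite exprn_gt0.
- by move=> i /negbTE->.
move=> j Pj; apply: contra qt => /eqP E; rewrite rootE /q horner_prod.
rewrite (bigD1 j) //=; suff -> : (p j).[t] = 0 by rewrite mul0r.
rewrite horner_sum -[RHS]E [RHS](bigID (mem F)) /= [X in _ = _ + X]big1 ?addr0.
  by apply: eq_bigr => i iF; rewrite iF hornerZ hornerXn mulrC.
by move=> i /negbTE->; rewrite mul0r.
Qed.

(** Otherwise the points (g1 v, g2 v) of the plane, for v in F, are parallel to
    all those for v in G. Then one combination of g1 and g2 vanishes on
    both F and G, which is impossible for two distinct facets. *)
Lemma crossing_facets g1 g2 gF gG : facet_fun g1 -> facet_fun g2 ->
  facet_fun gF -> facet_fun gG -> zeros g1 != zeros g2 ->
  zeros gF != zeros gG ->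
  exists v, v \in zeros gF /\ exists2 w, w \in zeros gG &
    g1 v * g2 w - g2 v * g1 w != 0.
Proof.
move=> f1 f2 fF fG n12 nFG; apply: contrapT => H.
have {}H v w : v \in zeros gF -> w \in zeros gG -> g1 v * g2 w = g2 v * g1 w.
  move=> vF wG; apply/eqP; rewrite -subr_eq0; apply/negPn/negP => nz.
  by apply: H; exists v; split=> //; exists w.
have [U1 _ g1n0 _] := f1; have [U2 _ g2n0 _] := f2.
have notboth g : facet_fun g ->
    exists2 w, w \in zeros g & (g1 w != 0) || (g2 w != 0).
  move=> fg; apply: contrapT => nw.
  have z w : w \in zeros g -> (w \in zeros g1) && (w \in zeros g2).
    move=> wg; rewrite !in_zeros -[_ && _]negbK negb_and; apply/negP => h.
    by apply: nw; exists w.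
  have z1 : zeros g1 = zeros g.
    by apply: facet_fun_maximal => //; apply/subsetP => w /z/andP[].
  have z2 : zeros g2 = zeros g.
    by apply: facet_fun_maximal => //; apply/subsetP => w /z/andP[].
  by move: n12; rewrite z1 z2 eqxx.
have [w wG nw] := notboth _ fG; have [v vF nv] := notboth _ fF.
have [_ _ [j gFj] FP] := fF; have [_ _ [j' gGj] GP] := fG.
pose k i := g2 w * g1 i + - g1 w * g2 i.
have Uk : U k by exact: U_lin.
have kF i : i \in zeros gF -> k i = 0.
  by move=> iF; rewrite /k mulrC (H _ _ iF wG); ring.
have kG i : i \in zeros gG -> k i = 0.
  move=> iG; have e1 := H _ _ vF wG; have e2 := H _ _ vF iG; rewrite /k.
  have [v0|v0] := eqVneq (g1 v) 0.
    have v2 : g2 v != 0 by move: nv; rewrite v0 eqxx.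
    have w1 : g1 w = 0.
      by apply/eqP; move/eqP: e1; rewrite v0 mul0r eq_sym mulf_eq0 (negbTE v2).
    have i1 : g1 i = 0.
      by apply/eqP; move/eqP: e2; rewrite v0 mul0r eq_sym mulf_eq0 (negbTE v2).
    by rewrite w1 i1; ring.
  apply: (mulfI v0); rewrite mulr0 mulrDr mulrA e1.
  by rewrite mulrCA e2; ring.
have [k0|kn0] := pselect (forall i, k i = 0).
  have eqk i : g2 w * g1 i = g1 w * g2 i.
    by apply/eqP; rewrite -subr_eq0; apply/eqP; rewrite -[RHS](k0 i) /k; ring.
  have w1 : g1 w != 0.
    apply: contraTneq nw => w1; rewrite w1 eqxx /=; have [i ni] := g1n0.
    by have /eqP := eqk i; rewrite w1 mul0r mulf_eq0 (negbTE ni) orbF negbK.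
  have w2 : g2 w != 0.
    apply: contraTneq w1 => w2; have [i ni] := g2n0.
    by have /esym/eqP := eqk i; rewrite w2 mul0r mulf_eq0 (negbTE ni) orbF negbK.
  move/negP: n12; apply; apply/eqP/setP => i; rewrite !in_zeros.
  rewrite -[g1 i == 0]/(false || _) -[false in LHS](negbTE w2) -mulf_eq0 eqk.
  by rewrite mulf_eq0 (negbTE w1).
have {}kn0 : exists i, k i != 0.
  apply: contrapT => h; apply: kn0 => i; apply/eqP/negPn/negP => ni.
  by apply: h; exists i.
have e1 : zeros k = zeros gF.
  by apply: facet_fun_maximal => //; apply/subsetP => i /kF; rewrite in_zeros => ->.
have e2 : zeros k = zeros gG.
  by apply: facet_fun_maximal => //; apply/subsetP => i /kG; rewrite in_zeros => ->.
by move: nFG; rewrite -e1 -e2 eqxx.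
Qed.

Definition facet_sets : {set {set I}} :=
  [set A | `[<exists g, facet_fun g /\ zeros g = A>]].

Lemma facet_setsP A :
  A \in facet_sets <-> exists g, facet_fun g /\ zeros g = A.
Proof. by rewrite inE; split=> /asboolP. Qed.

Lemma facet_set_neighbor A x : A \in facet_sets -> x \in A ->
  exists B, [/\ B \in facet_sets, B != A,
    exists2 v, v \notin A & B = v |: (A :\ x) &
    forall C, C \in facet_sets -> C != A -> A :\ x \subset C -> C = B].
Proof.
move=> /facet_setsP[g [fg <-]] xA.
have [g' [v [fg' vA E un]]] := facet_fun_neighbor fg xA; exists (zeros g'); split.
- by apply/facet_setsP; exists g'.
- by apply: contraNneq vA => <-; rewrite E setU11.
- by exists v.
- by move=> _ /facet_setsP[g2 [fg2 <-]] n2 s2; exact: un.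
Qed.

Lemma facet_set_ridge A B a : A \in facet_sets -> B \in facet_sets ->
  A != B -> a \in A -> A :\ a \subset B -> exists2 b, b \in B & A :\ a = B :\ b.
Proof.
move=> AS BS nAB aA sB.
have [B' [_ _ [v vA E] un]] := facet_set_neighbor AS aA.
have {}E : B = v |: (A :\ a) by rewrite -E; apply: un; rewrite // eq_sym.
exists v; first by rewrite E setU11.
by rewrite E setU1K // inE (negbTE vA) andbF.
Qed.

Lemma facet_set_thin A B C a : A \in facet_sets -> B \in facet_sets ->
  C \in facet_sets -> B != A -> C != A -> a \in A -> A :\ a \subset B ->
  A :\ a \subset C -> B = C.
Proof.
move=> AS BS CS nB nC aA sB sC.
by have [B' [_ _ _ un]] := facet_set_neighbor AS aA; rewrite (un B) // (un C).
Qed.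

Lemma weighted_sum_eq0 (r : I -> R) g :
  (forall i, i \notin zeros g -> r i = 0) -> \sum_i r i * g i = 0.
Proof.
move=> r0; rewrite big1 // => i _; have [|/r0->] := boolP (i \in zeros g).
  by rewrite in_zeros => /eqP->; rewrite mulr0.
by rewrite mul0r.
Qed.

Lemma weighted_sum_gt0 (r : I -> R) Z g : Z \in facet_sets ->
  (forall i, i \in Z -> 0 < r i) -> (forall i, i \notin Z -> r i = 0) ->
  facet_fun g -> zeros g != Z -> 0 < \sum_i r i * g i.
Proof.
move=> /facet_setsP[z [fz <-]] r_pos r0 [Ug g0 gn0 _] nz.
have rg i : 0 <= r i * g i.
  by apply: mulr_ge0 => //; have [/r_pos/ltW|/r0->] := boolP (i \in zeros z).
rewrite lt_neqAle sumr_ge0 // andbT eq_sym psumr_eq0 //.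
apply: contra nz => /allP al; apply/eqP/facet_fun_maximal => //.
apply/subsetP => i iz; have := al i (mem_index_enum _).
by rewrite /= mulf_eq0 (gt_eqF (r_pos i iz)) in_zeros.
Qed.

Section Sweep.
Variables (F G : {set I}) (gf : {set I} -> I -> R) (s t : I -> R).
Hypothesis F_facet : F \in facet_sets.
Hypothesis G_facet : G \in facet_sets.
Hypothesis nFG : F != G.
Hypothesis gf_facet : forall A, A \in facet_sets -> facet_fun (gf A).
Hypothesis zeros_gf : forall A, A \in facet_sets -> zeros (gf A) = A.
Hypothesis s_pos : forall i, i \in F -> 0 < s i.
Hypothesis s0 : forall i, i \notin F -> s i = 0.
Hypothesis t_pos : forall i, i \in G -> 0 < t i.
Hypothesis t0 : forall i, i \notin G -> t i = 0.

(** With s and t carried by F and G, value_F A and value_G A are the values of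
    the chosen function of A at two points, interior to F and to G up to scale. *)
Definition value_F A := \sum_i s i * gf A i.
Definition value_G A := \sum_i t i * gf A i.

Hypothesis generic : forall A B, A \in facet_sets -> B \in facet_sets ->
  A != B -> value_F A * value_G B != value_F B * value_G A.

(** A projective parameter of the point where the line through these two points
    meets the hyperplane of A: it is 0 for F and 1 for G, and the segment from 0
    to 1 is the part of the line that is outside the polytope. *)
Definition sweep_time A := value_F A / (value_F A + value_G A).

Let value_FF : value_F F = 0.
Proof. by apply: weighted_sum_eq0; rewrite zeros_gf. Qed.

Let value_GG : value_G G = 0.
Proof. by apply: weighted_sum_eq0; rewrite zeros_gf. Qed.

Let value_F_gt0 A : A \in facet_sets -> A != F -> 0 < value_F A.
Proof.
move=> AS nAF; apply: (weighted_sum_gt0 F_facet) => //; first exact: gf_facet.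
by rewrite zeros_gf.
Qed.

Let value_G_gt0 A : A \in facet_sets -> A != G -> 0 < value_G A.
Proof.
move=> AS nAG; apply: (weighted_sum_gt0 G_facet) => //; first exact: gf_facet.
by rewrite zeros_gf.
Qed.

Let value_gt0 A : A \in facet_sets -> 0 < value_F A + value_G A.
Proof.
move=> AS; have [->|nAF] := eqVneq A F.
  by rewrite value_FF add0r value_G_gt0.
have [->|nAG] := eqVneq A G.
  by rewrite value_GG addr0 value_F_gt0 // eq_sym.
by rewrite addr_gt0 ?value_F_gt0 ?value_G_gt0.
Qed.

Lemma sweep_time_lt A B : A \in facet_sets -> B \in facet_sets ->
  (sweep_time A < sweep_time B) =
  (value_F A * value_G B < value_F B * value_G A).
Proof.
move=> /value_gt0 Ap /value_gt0 Bp.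
rewrite /sweep_time ltr_pdivrMr // mulrAC ltr_pdivlMr //.
by apply/idP/idP => h; lra.
Qed.

Lemma sweep_time_total A B : A \in facet_sets -> B \in facet_sets -> A != B ->
  ~~ (sweep_time A < sweep_time B) -> sweep_time B < sweep_time A.
Proof.
move=> AS BS nAB; rewrite !sweep_time_lt // -leNgt le_eqVlt => /predU1P[E|//].
by have := generic AS BS nAB; rewrite E eqxx.
Qed.

Lemma sweep_time_first A : A \in facet_sets -> A != F ->
  sweep_time F < sweep_time A.
Proof.
move=> AS nAF; rewrite sweep_time_lt // value_FF mul0r.
by rewrite mulr_gt0 ?value_F_gt0 ?value_G_gt0.
Qed.

Lemma sweep_time_last A : A \in facet_sets -> A != G ->
  sweep_time A < sweep_time G.
Proof.
move=> AS nAG; rewrite sweep_time_lt // value_GG mulr0.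
by rewrite mulr_gt0 ?value_F_gt0 ?value_G_gt0 // eq_sym.
Qed.

(** The sign sg lets the same argument serve for minima and for maxima. *)
Let local_sweep (sg : R) A B X : A \in facet_sets -> B \in facet_sets ->
  B != A -> X \subset A -> X \subset B ->
  (forall x C, x \in A :\: X -> C \in facet_sets -> C != A ->
     A :\ x \subset C ->
     0 < sg * (value_F C * value_G A - value_F A * value_G C)) ->
  0 < sg * (value_F B * value_G A - value_F A * value_G B).
Proof.
move=> AS BS nBA XA XB hC.
pose p i := sg * (s i * value_G A - value_F A * t i).
have pE C : \sum_i p i * gf C i =
    sg * (value_F C * value_G A - value_F A * value_G C).
  rewrite [value_F C]/value_F [value_G C]/value_G mulr_suml mulr_sumr.
  rewrite -sumrB mulr_sumr.
  by apply: eq_bigr => i _; rewrite /p; ring.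
have /choice[nb hnb] : forall x, exists C, x \in A ->
    [/\ C \in facet_sets, C != A & A :\ x \subset C].
  move=> x; have [xA|_] := boolP (x \in A); last by exists A.
  have [C [CS nCA [v _ E] _]] := facet_set_neighbor AS xA.
  by exists C => _; split=> //; rewrite E subsetUr.
rewrite -pE; apply: (@facet_local_min p (gf A) (gf B) X (fun x => gf (nb x)));
  rewrite ?zeros_gf //; try exact: gf_facet.
  by rewrite pE; ring.
move=> x xAX; have /setDP[xA _] := xAX; have [CS nCA sC] := hnb x xA.
by split; rewrite ?zeros_gf ?pE //; [exact: gf_facet | exact: (hC x)].
Qed.

Lemma sweep_local_min A B X : A \in facet_sets -> B \in facet_sets ->
  B != A -> X \subset A -> X \subset B ->
  (forall x C, x \in A :\: X -> C \in facet_sets -> C != A ->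
     A :\ x \subset C -> sweep_time A < sweep_time C) ->
  sweep_time A < sweep_time B.
Proof.
move=> AS BS nBA XA XB hC; rewrite sweep_time_lt //.
suff : 0 < 1 * (value_F B * value_G A - value_F A * value_G B) by lra.
apply: (@local_sweep 1 A B X) => // x C xAX CS nCA sC.
by have := hC x C xAX CS nCA sC; rewrite sweep_time_lt //; lra.
Qed.

Lemma sweep_local_max A B : A \in facet_sets -> B \in facet_sets -> B != A ->
  (forall x C, x \in A -> C \in facet_sets -> C != A -> A :\ x \subset C ->
     sweep_time C < sweep_time A) ->
  sweep_time B < sweep_time A.
Proof.
move=> AS BS nBA hC; rewrite sweep_time_lt //.
suff : 0 < -1 * (value_F B * value_G A - value_F A * value_G B) by lra.
apply: (@local_sweep (-1) A B set0); rewrite ?sub0set // => x C.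
rewrite setD0 => xA CS nCA sC.
by have := hC x C xA CS nCA sC; rewrite sweep_time_lt //; lra.
Qed.

Definition sweep := sort (fun A B => sweep_time A <= sweep_time B)
  (enum facet_sets).

Lemma mem_sweep A : (A \in sweep) = (A \in facet_sets).
Proof. by rewrite mem_sort mem_enum. Qed.

Lemma sweep_uniq : uniq sweep.
Proof. by rewrite sort_uniq enum_uniq. Qed.

Lemma sweep_split D A E : sweep = D ++ A :: E ->
  [/\ A \in facet_sets,
      forall B, B \in D ->
        [/\ B \in facet_sets, B != A & sweep_time B < sweep_time A] &
      forall B, B \in E ->
        [/\ B \in facet_sets, B != A & sweep_time A < sweep_time B]].
Proof.
move=> swE; have AS : A \in facet_sets.
  by rewrite -mem_sweep swE mem_cat mem_head orbT.
have [AD AE] : A \notin D /\ A \notin E.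
  have := sweep_uniq; rewrite swE cat_uniq /=.
  by move=> /and4P[_ /norP[-> _] -> _].
have : sorted (fun A B => sweep_time A <= sweep_time B) sweep.
  by apply: sort_sorted => B C; exact: le_total.
rewrite sorted_pairwise; last by move=> B C H; exact: le_trans.
rewrite swE pairwise_cat /= => /and3P[/allrelP DA _ /andP[/allP AleE _]].
split=> // B Bin.
- have BS : B \in facet_sets by rewrite -mem_sweep swE mem_cat Bin.
  have nBA : B != A by apply: contraNneq AD => <-.
  split=> //; apply: sweep_time_total; rewrite // 1?eq_sym // -leNgt.
  by apply: DA; rewrite ?mem_head.
- have BS : B \in facet_sets by rewrite -mem_sweep swE mem_cat inE Bin !orbT.
  have nBA : B != A by apply: contraNneq AE => <-.
  by split=> //; apply: sweep_time_total; rewrite // -leNgt; exact: AleE.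
Qed.

Lemma sweep_before D A E B : sweep = D ++ A :: E -> B \in facet_sets ->
  sweep_time B < sweep_time A -> B \in D.
Proof.
move=> swE BS lt; have [_ _ AE] := sweep_split swE.
have : B \in sweep by rewrite mem_sweep.
rewrite swE mem_cat inE => /or3P[//|/eqP BA|/AE[_ _ lt']].
  by rewrite BA ltxx in lt.
by have := lt_trans lt lt'; rewrite ltxx.
Qed.

Definition restriction A := [set a in A | [exists B, [&& B \in facet_sets,
  B != A, A :\ a \subset B & sweep_time B < sweep_time A]]].

Lemma restrictionP A a : reflect
  (a \in A /\ exists B, [/\ B \in facet_sets, B != A, A :\ a \subset B &
                            sweep_time B < sweep_time A])
  (a \in restriction A).
Proof.
rewrite inE; apply: (iffP andP) => -[aA].
  by move/existsP => [B /and4P[]]; split=> //; exists B.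
by move=> [B [? ? ? ?]]; split=> //; apply/existsP; exists B; apply/and4P.
Qed.

(** If a facet B before A contained a set X that contains the restriction set
    of A, then A would precede all its neighbours around X, but not B. Dually, if
    all neighbours of A precede A, then A is the last facet. *)
Lemma sweep_shelling D A E : sweep = D ++ A :: E ->
  exists Q : {set I}, [/\ Q \subset A,
    forall X, X \subset A -> faces_of D X = ~~ (Q \subset X) &
    (Q == A) = (E == [::])].
Proof.
move=> swE; have [AS DA EA] := sweep_split swE.
have QA : restriction A \subset A.
  by apply/subsetP => a /restrictionP[].
exists (restriction A); split=> // [X XA|].
  have [QX|] := boolP (_ \subset X).
    apply/hasPn => B /DA[BS nBA lt]; apply/negP => XB; move: lt.
    apply/negP; rewrite -leNgt ltW //; apply: (@sweep_local_min A B X) => //.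
    move=> x C /setDP[xA xX] CS nCA sC; apply: sweep_time_total => //.
    apply: contra xX => lt; apply: (subsetP QX).
    by apply/restrictionP; split=> //; exists C.
  case/subsetPn => z /restrictionP[zA [B [BS nBA sB lt]]] zX; apply/hasP.
  exists B; first exact: (sweep_before swE BS lt).
  by apply: subset_trans sB; rewrite subsetD1 XA.
apply/eqP/eqP => [AQ|E0].
  case: E EA swE => // B E EA swE.
  have [BS nBA] := EA B (mem_head _ _); apply: contraTeq => _.
  rewrite -leNgt ltW //; apply: sweep_local_max => // x C xA CS nCA sC.
  move: (xA); rewrite -{1}AQ => /restrictionP[_ [C' [C'S nC'A sC' lt]]].
  by rewrite (facet_set_thin AS CS C'S nCA nC'A xA sC sC').
apply/eqP; rewrite eqEsubset QA; apply/subsetP => a aA.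
have [B [BS nBA [v _ EB] _]] := facet_set_neighbor AS aA.
have /DA[_ _ lt] : B \in D.
  by move: BS; rewrite -mem_sweep swE E0 mem_cat inE (negbTE nBA) orbF.
by apply/restrictionP; split=> //; exists B; rewrite EB subsetUr -EB.
Qed.

Lemma head_sweep : head set0 sweep = F.
Proof.
have := F_facet; rewrite -mem_sweep; case E: sweep => [//|A D] _ /=.
apply/eqP/negPn/negP => nAF; have [AS _ _] := sweep_split (D := [::]) E.
by have := sweep_before (D := [::]) E F_facet (sweep_time_first AS nAF).
Qed.

Lemma last_sweep : last set0 sweep = G.
Proof.
have [D [A E]] : exists D A, sweep = D ++ [:: A].
  have := G_facet; rewrite -mem_sweep; case: (lastP sweep) => // D A _.
  by exists D, A; rewrite cats1.
rewrite E last_cat /=.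
apply/eqP/negPn/negP => nAG; have [AS DA _] := sweep_split E.
have lt := sweep_time_last AS nAG.
have /DA[_ _] : G \in D.
  have : G \in sweep by rewrite mem_sweep.
  by rewrite E mem_cat inE eq_sym (negbTE nAG) orbF.
by rewrite ltNge ltW.
Qed.

Lemma sweep_walk : exists c : seq {set I},
  [/\ sorted adjacent c, uniq c, forall A, (A \in c) = faces_of sweep A,
      head set0 c = F & last set0 c = G].
Proof.
have ridge A B a : A \in sweep -> B \in sweep -> A != B -> a \in A ->
    A :\ a \subset B -> exists2 b, b \in B & A :\ a = B :\ b.
  by rewrite !mem_sweep; exact: facet_set_ridge.
have thin A B C a : A \in sweep -> B \in sweep -> C \in sweep -> B != A ->
    C != A -> a \in A -> A :\ a \subset B -> A :\ a \subset C -> B = C.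
  by rewrite !mem_sweep; exact: facet_set_thin.
have := shelling_walk sweep_uniq sweep_shelling ridge thin.
rewrite head_sweep last_sweep; apply.
have FG_sweep : {subset [:: F; G] <= sweep}.
  by move=> A; rewrite mem_seq2 mem_sweep => /orP[]/eqP->.
by apply: (uniq_leq_size (s1 := [:: F; G])); rewrite //= inE nFG.
Qed.

End Sweep.

(** The weights are chosen generic one after the other: first t, such that the
    linear conditions on s are nontrivial, then s. *)
Theorem facet_fun_walk gF gG : facet_fun gF -> facet_fun gG ->
  zeros gF != zeros gG ->
  exists c : seq {set I},
  [/\ sorted adjacent c, uniq c,
      forall A, A \in c <-> exists2 g, facet_fun g & A \subset zeros g,
      head set0 c = zeros gF & last set0 c = zeros gG].
Proof.
move=> fF fG nFG; set F := zeros gF in nFG *; set G := zeros gG in nFG *.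
have FS : F \in facet_sets by apply/facet_setsP; exists gF.
have GS : G \in facet_sets by apply/facet_setsP; exists gG.
have /choice[gf gfP] : forall A, exists g, A \in facet_sets ->
    facet_fun g /\ zeros g = A.
  move=> A; have [/facet_setsP[g hg]|_] := boolP (A \in facet_sets).
    by exists g.
  by exists (fun=> 0).
have fgf A : A \in facet_sets -> facet_fun (gf A) by case/gfP.
have zgf A : A \in facet_sets -> zeros (gf A) = A by case/gfP.
pose P (AB : {set I} * {set I}) :=
  [&& AB.1 \in facet_sets, AB.2 \in facet_sets & AB.1 != AB.2].
have /choice[vf vfP] : forall AB, exists v, P AB ->
    v \in F /\ exists2 w, w \in G &
    gf AB.1 v * gf AB.2 w - gf AB.2 v * gf AB.1 w != 0.
  move=> [A B]; have [/and3P[/= AS BS nAB]|nP] := boolP (P (A, B)).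
    have [|v [vF hw]] := crossing_facets (fgf A AS) (fgf B BS) fF fG _ nFG.
      by rewrite !zgf.
    by exists v => _; split.
  have [i _] : exists i : I, true.
    apply: contrapT => nI; move/eqP: nFG; apply; apply/setP => i.
    by case: nI; exists i.
  by exists i.
have [t [t_pos t0 tP]] := @generic_weights _ P G
  (fun AB w => gf AB.1 (vf AB) * gf AB.2 w - gf AB.2 (vf AB) * gf AB.1 w)
  (fun AB pAB => (vfP AB pAB).2).
have [|s [s_pos s0 sP]] := @generic_weights _ P F
  (fun AB v => gf AB.1 v * value_G gf t AB.2 - gf AB.2 v * value_G gf t AB.1).
  move=> AB pAB; exists (vf AB); first by have [] := vfP AB pAB.
  have := tP AB pAB; congr (_ != _); rewrite /value_G !mulr_sumr -sumrB.
  by apply: eq_bigr => i _; ring.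
have generic A B : A \in facet_sets -> B \in facet_sets -> A != B ->
    value_F gf s A * value_G gf t B != value_F gf s B * value_G gf t A.
  move=> AS BS nAB; rewrite -subr_eq0; have /sP : P (A, B) by apply/and3P.
  congr (_ != _); rewrite /value_F !mulr_suml -sumrB.
  by apply: eq_bigr => i _; ring.
have [c [srt un inc hd ls]] :=
  sweep_walk FS GS nFG fgf zgf s_pos s0 t_pos t0 generic.
exists c; split=> // A; rewrite inc; split.
  move=> /hasP[B]; rewrite mem_sweep => BS AB; exists (gf B); first exact: fgf.
  by rewrite zgf.
move=> [g fg Ag]; apply/hasP; exists (zeros g) => //.
by rewrite mem_sweep; apply/facet_setsP; exists g.
Qed.

End FacetFunctions.

(** * Hulls of finite families of points and their faces *)

Section Hulls.
Local Open Scope ring_scope.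
Variables (R : realType) (n N : nat) (v : 'I_N -> 'rV[R]_n).
Implicit Types (A B : {set 'I_N}) (a : 'I_N -> R) (x y : 'rV[R]_n).
Implicit Types (c : 'cV[R]_n) (b : R).

Definition hull A : set 'rV[R]_n := fun x => exists a,
  [/\ forall i, 0 <= a i, forall i, i \notin A -> a i = 0, \sum_i a i = 1 &
      x = \sum_i a i *: v i].

Lemma hull_vertex A i : i \in A -> hull A (v i).
Proof.
move=> iA; exists (fun j => (j == i)%:R); split.
- by move=> j; rewrite ler0n.
- by move=> j; apply: contraNeq; rewrite pnatr_eq0 eqb0 negbK => /eqP->.
- by rewrite (bigD1 i) //= eqxx big1 ?addr0 // => j /negbTE->.
- rewrite (bigD1 i) //= eqxx scale1r big1 ?addr0 // => j /negbTE->.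
  by rewrite scale0r.
Qed.

Lemma hullS A B : A \subset B -> (hull A `<=` hull B)%classic.
Proof.
move=> /subsetP AB x [a [a0 aA a1 ->]]; exists a; split=> // i iB.
by apply: aA; apply: contra iB; exact: AB.
Qed.

Lemma convE x y (t : {i01 R}) :
  conv t (x : convex_lmodType 'rV[R]_n) y =
  t%:inum *: x + (1 - t%:inum) *: y :> 'rV[R]_n.
Proof. by []. Qed.

Lemma hull_convex A : convex_set (hull A).
Proof.
move=> x y t; rewrite !classical_sets.in_setE.
move=> [a [a0 aA a1 ->]] [a' [a'0 a'A a'1 ->]].
rewrite convE; have t0 : 0 <= t%:inum by []; have t1 : t%:inum <= 1 by [].
move: (t%:inum) t0 t1 => {}t t0 t1.
exists (fun i => t * a i + (1 - t) * a' i); split.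
- by move=> i; rewrite addr_ge0 // mulr_ge0 // subr_ge0.
- by move=> i iA; rewrite aA ?a'A // !mulr0 addr0.
- by rewrite big_split /= -!mulr_sumr a1 a'1; ring.
- rewrite !scaler_sumr -big_split /=; apply: eq_bigr => i _.
  by rewrite [RHS]scalerDl !scalerA.
Qed.

(** By induction on A, splitting off one point of a convex combination. *)
Lemma hull_min A (C : set 'rV[R]_n) : @convex_set R 'rV[R]_n C ->
  (forall i, i \in A -> C (v i)) -> (hull A `<=` C)%classic.
Proof.
move=> Cc; have [m] := ubnP #|A|; elim: m A => // m IH A cA AC.
move=> x [a [a0 aA a1 ->]].
have [A0|/set0Pn[i iA]] := eqVneq A set0.
  have : \sum_i a i = 0 by rewrite big1 // => i _; rewrite aA // A0 inE.
  by rewrite a1 => /eqP; rewrite oner_eq0.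
have rest : \sum_(j | j != i) a j = 1 - a i.
  by rewrite -a1 [in RHS](bigD1 i) //= addrAC subrr add0r.
have rest0 : 0 <= 1 - a i by rewrite -rest sumr_ge0.
have [ai1|ai1] := eqVneq (a i) 1.
  rewrite (bigD1 i) //= ai1 scale1r big1 ?addr0; first exact: AC.
  move=> j ji; move/eqP: rest; rewrite ai1 subrr psumr_eq0 // => /allP.
  by move=> /(_ j (mem_index_enum _)); rewrite ji => /eqP->; rewrite scale0r.
have lt1 : 0 < 1 - a i by rewrite lt_neqAle rest0 andbT eq_sym subr_eq0 eq_sym.
pose y := \sum_(j | j != i) (a j / (1 - a i)) *: v j.
have Cy : C y.
  apply: (IH (A :\ i)).
  - rewrite -ltnS; apply: leq_trans cA; rewrite ltnS.
    by rewrite (cardsD1 i A) iA.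
  - by move=> j; rewrite in_setD1 => /andP[_]; exact: AC.
  exists (fun j => if j == i then 0 else a j / (1 - a i)); split.
  - by move=> j; case: ifP => // _; rewrite divr_ge0.
  - move=> j; rewrite in_setD1 negb_and negbK; case: eqP => //= _ jA.
    by rewrite aA // mul0r.
  - transitivity ((\sum_(j | j != i) a j) / (1 - a i)).
      rewrite (bigD1 i) //= eqxx add0r mulr_suml.
      by apply: eq_bigr => j /negbTE->.
    by rewrite rest divff // lt0r_neq0.
  - rewrite /y [RHS](bigD1 i) //= eqxx scale0r add0r.
    by apply: eq_bigr => j /negbTE->.
have ai01 : a i <= 1 by rewrite -subr_ge0.
have := Cc (v i) y (Itv01 (a0 i) ai01).
rewrite !classical_sets.in_setE => /(_ (AC i iA) Cy).
rewrite convE /=; congr (C _); rewrite (bigD1 i) //=; congr (_ + _).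
rewrite scaler_sumr; apply: eq_bigr => j _.
by rewrite scalerA mulrC divfK // gt_eqF.
Qed.

Lemma convex_hullE : convex_hull (range v) = hull [set: 'I_N].
Proof.
apply/seteqP; split.
  apply: smallest_sub; first exact: hull_convex.
  by move=> _ [i _ <-]; apply: hull_vertex; rewrite inE.
move=> x hx C [Cc Cv]; apply: hull_min hx => // i _.
by apply: Cv; exists i.
Qed.

(** Affine functions are parametrized as in the definition of a face. *)
Definition height c b x := b - (x *m c) 0 0.

Lemma height_sum (J : finType) (w : J -> 'rV[R]_n) (r : J -> R) c b :
  \sum_j r j = 1 -> height c b (\sum_j r j *: w j) = \sum_j r j * height c b (w j).
Proof.
move=> r1; rewrite /height mulmx_suml summxE.
under [RHS]eq_bigr do rewrite mulrBr.
rewrite sumrB -mulr_suml r1 mul1r; congr (_ - _).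
by apply: eq_bigr => j _; rewrite -scalemxAl mxE.
Qed.

Definition affine_fun (f : 'I_N -> R) :=
  exists c b, forall i, f i = height c b (v i).

Lemma affine_fun_lin (r s : R) f g : affine_fun f -> affine_fun g ->
  affine_fun (fun i => r * f i + s * g i).
Proof.
move=> [c [b fE]] [c' [b' gE]]; exists (r *: c + s *: c'), (r * b + s * b') => i.
rewrite fE gE /height mulmxDr -!scalemxAr !mxE; ring.
Qed.

(** A nonnegative affine function vanishes at a convex combination only if it
    vanishes at all points that have a positive coefficient. *)
Lemma hull_zeros c b : (forall i, 0 <= height c b (v i)) ->
  hull (zeros (fun i => height c b (v i))) =
  [set x | hull [set: 'I_N] x /\ (x *m c) 0 0 = b]%classic.
Proof.
move=> h0; apply/seteqP; split=> x.
  move=> hx; split; first exact: hullS (subsetT _) _ hx.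
  have [a [a0 aZ a1 xE]] := hx.
  have : height c b x = 0.
    rewrite xE height_sum // big1 // => i _.
    have [|iZ] := boolP (i \in zeros (fun i => height c b (v i))).
      by rewrite in_zeros => /eqP->; rewrite mulr0.
    by rewrite aZ // mul0r.
  by move/eqP; rewrite subr_eq0 => /eqP.
move=> [[a [a0 _ a1 xE]] xb]; exists a; split=> // i.
rewrite in_zeros => hi; apply/eqP.
have : height c b x = 0 by rewrite /height xb subrr.
rewrite xE height_sum // => /eqP; rewrite psumr_eq0 => [|j _]; last exact: mulr_ge0.
move=> /allP/(_ i (mem_index_enum _)) /=.
by rewrite mulf_eq0 (negbTE hi) orbF.
Qed.

Lemma face_hullP F : face (hull [set: 'I_N]) F <->
  exists g, [/\ affine_fun g, forall i, 0 <= g i & F = hull (zeros g)].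
Proof.
split=> [[c [b [Pb ->]]]|[g [[c [b gE]] g0 ->]]].
  have h0 i : 0 <= height c b (v i).
    by rewrite subr_ge0; apply: Pb; apply: hull_vertex; rewrite inE.
  exists (fun i => height c b (v i)); split=> //; first by exists c, b.
  by rewrite hull_zeros.
have zE : zeros g = zeros (fun i => height c b (v i)).
  by apply/setP => i; rewrite !in_zeros gE.
have h0 i : 0 <= height c b (v i) by rewrite -gE.
exists c, b; split; last by rewrite zE hull_zeros.
move=> x [a [a0 _ a1 xE]]; rewrite -subr_ge0 -[X in 0 <= X]/(height c b x) xE.
by rewrite height_sum // sumr_ge0 // => i _; rewrite mulr_ge0.
Qed.

(** A face is determined by the points it contains, so that inclusion of faces
    can be tested on sets of indices. *)
Lemma hull_subP A B g : affine_fun g -> (forall i, 0 <= g i) -> B = zeros g ->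
  (hull A `<=` hull B)%classic -> A \subset B.
Proof.
move=> [c [b gE]] g0 BE AB; apply/subsetP => i /hull_vertex/AB.
have h0 j : 0 <= height c b (v j) by rewrite -gE.
have zE : zeros g = zeros (fun i => height c b (v i)).
  by apply/setP => j; rewrite !in_zeros gE.
rewrite {1}BE zE hull_zeros // => -[_ hi].
by rewrite BE in_zeros gE /height hi subrr.
Qed.

(** * Dimension and facets *)

(** The indices outside A are sent to the base point, to have a
    spanning family indexed by the whole of 'I_N. *)
Definition anchored (o : 'I_N) A i := (if i \in A then v i else v o) - v o.

Definition directions (o : 'I_N) A : {vspace 'rV[R]_n} :=
  <<[tuple anchored o A i | i < N]>>%VS.

Lemma mem_directions o A i : i \in A -> v i - v o \in directions o A.
Proof.
move=> iA; apply: memv_span; apply/mapP; exists i; rewrite ?mem_enum //.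
by rewrite /anchored iA.
Qed.

Lemma sub_directions o A (W : {vspace 'rV[R]_n}) :
  (forall i, i \in A -> v i - v o \in W) -> (directions o A <= W)%VS.
Proof.
move=> AW; apply/span_subvP => _ /mapP[i _ ->]; rewrite /anchored.
by case: ifP => [/AW//|_]; rewrite subrr mem0v.
Qed.

Lemma affine_hull_directions o A : o \in A ->
  affine_hull (hull A) = [set v o + u | u in [set` directions o A]]%classic.
Proof.
move=> oA; apply/seteqP; split=> x.
  move=> [k [w [r [Aw r1 ->]]]].
  exists (\sum_j r j *: (w j - v o)).
    rewrite /=; apply: memv_suml => j _; apply: memvZ.
    have [a [_ aA a1 ->]] := Aw j.
    have -> : \sum_i a i *: v i - v o = \sum_i a i *: (v i - v o).
      under [RHS]eq_bigr do rewrite scalerBr.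
      by rewrite sumrB -scaler_suml a1 scale1r.
    apply: memv_suml => i _; have [iA|/aA->] := boolP (i \in A).
      by apply: memvZ; exact: mem_directions.
    by rewrite scale0r mem0v.
  under eq_bigr do rewrite scalerBr.
  by rewrite sumrB -scaler_suml r1 scale1r addrC subrK.
move=> [u /= uW <-].
pose X := [tuple anchored o A i | i < N]; pose r i := coord X i u.
exists N, (fun i => if i \in A then v i else v o).
exists (fun i => r i + (i == o)%:R * (1 - \sum_j r j)); split.
- by move=> i; case: ifP => iA; apply: hull_vertex.
- rewrite big_split /= -mulr_suml [X in _ + X * _](bigD1 o) //= eqxx.
  rewrite [X in _ + (_ + X) * _]big1 => [|i /negbTE->//].
  by rewrite addr0 mul1r addrC subrK.
- under [RHS]eq_bigr do rewrite scalerDl.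
  rewrite big_split /= [X in _ = _ + X](bigD1 o) //= eqxx oA mul1r.
  rewrite [X in _ = _ + (_ + X)]big1 => [|i /negbTE->]; last first.
    by rewrite mul0r scale0r.
  rewrite addr0 {1}(coord_span uW) scalerBl scale1r addrCA; congr (_ + _).
  rewrite scaler_suml -sumrB; apply: eq_bigr => i _.
  by rewrite -tnth_nth tnth_mktuple -scalerBr.
Qed.

Lemma affine_hull_height A c b x (r : R) :
  (forall i, i \in A -> height c b (v i) = r) ->
  affine_hull (hull A) x -> height c b x = r.
Proof.
move=> hA [k [w [s [Aw s1 ->]]]]; rewrite height_sum //.
under eq_bigr => j _.
  have -> : height c b (w j) = r.
    have [a [_ aA a1 ->]] := Aw j; rewrite height_sum //.
    transitivity (\sum_i a i * r); last by rewrite -mulr_suml a1 mul1r.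
    apply: eq_bigr => i _; have [/hA->//|/aA->] := boolP (i \in A).
    by rewrite !mul0r.
  over.
by rewrite -mulr_suml s1 mul1r.
Qed.

Lemma separating_functional (W : {vspace 'rV[R]_n}) u : u \notin W ->
  exists c : 'cV[R]_n, (forall x, x \in W -> x *m c = 0) /\ (u *m c) 0 0 != 0.
Proof.
move=> uW; pose M := \matrix_(i < \dim W) (vbasis W)`_i.
have rowM i : row i M \in W.
  by rewrite rowK; apply: vbasis_mem; rewrite mem_nth // size_tuple.
have WM x : x \in W -> (x <= M)%MS.
  move=> xW; rewrite (coord_vbasis xW); apply: summx_sub => i _.
  have <- : row i M = (vbasis W)`_i by rewrite rowK.
  by apply: scalemx_sub; exact: row_sub.
have uM : u *m cokermx M != 0.
  rewrite -submxE; apply: contra uW => /submxP[D ->].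
  rewrite mulmx_sum_row; apply: memv_suml => i _; exact: memvZ.
have [j uj] : exists j, (u *m cokermx M) 0 j != 0.
  apply: contrapT => H; move/eqP: uM; apply; apply/rowP => j; rewrite [RHS]mxE.
  by apply/eqP/negPn/negP => nz; apply: H; exists j.
exists (col j (cokermx M)); split=> [x /WM|].
  by rewrite submxE colE (mulmxA x (cokermx M)) => /eqP->; rewrite mul0mx.
by rewrite colE (mulmxA u (cokermx M)) -colE mxE.
Qed.

(** The matrix of homogeneous coordinates of the points is row free; a column of
    a right inverse gives the coefficients of the dual affine function. *)
Lemma affinely_independent_dual k (w : 'I_k -> 'rV[R]_n) j0 :
  affinely_independent w ->
  exists c b, forall j, height c b (w j) = (j == j0)%:R.
Proof.
move=> iw; pose M : 'M[R]_(k, 1 + n) := \matrix_j row_mx 1%:M (w j).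
have freeM : row_free M.
  apply: inj_row_free => u; rewrite mulmx_sum_row.
  under eq_bigr do rewrite rowK.
  move=> uM; have u0 : \sum_j u 0 j = 0.
    have /rowP/(_ (lshift n 0)) := uM; rewrite summxE mxE.
    by under eq_bigr do rewrite mxE row_mxEl mxE eqxx mulr1.
  have uw : \sum_j u 0 j *: w j = 0.
    apply/rowP => l; have /rowP/(_ (rshift 1 l)) := uM.
    rewrite summxE [X in _ = X]mxE => uMl; rewrite summxE [RHS]mxE -[RHS]uMl.
    apply: eq_bigr => j _.
    by rewrite [LHS]mxE [RHS]mxE row_mxEr.
  by apply/rowP => j; rewrite mxE (iw (u 0)).
pose d := col j0 (pinvmx M).
exists (- dsubmx d), (usubmx d 0 0) => j.
have : (row j M *m d) 0 0 = (j == j0)%:R.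
  by rewrite /d colE mulmxA -row_mul mulmxVp // -colE !mxE.
rewrite rowK -[d in LHS]vsubmxK mul_row_col mul1mx mxE => <-.
by rewrite /height mulmxN [X in _ - X]mxE opprK.
Qed.

Lemma hull0 x : ~ hull set0 x.
Proof.
move=> [a [_ a0 a1 _]]; have : \sum_i a i = 0.
  by rewrite big1 // => i _; rewrite a0 ?inE.
by rewrite a1 => /eqP; rewrite oner_eq0.
Qed.

Lemma has_dim_hull0 d : has_dim (hull set0) d <-> d = -1.
Proof.
split=> [[[]//|[x [W [hE _]]]]|->]; last first.
  by left; split=> //; apply/seteqP; split=> x // /hull0.
have : affine_hull (hull set0) x.
  by rewrite hE; exists 0; rewrite ?addr0 //= mem0v.
move=> [[|k] [w [r [hw r1 _]]]]; last by have /hull0 := hw ord0.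
by move: r1; rewrite big_ord0 => /esym/eqP; rewrite oner_eq0.
Qed.

Lemma translate_inj x y (W W' : {vspace 'rV[R]_n}) :
  [set x + u | u in [set` W]]%classic = [set y + u | u in [set` W']]%classic ->
  (W <= W')%VS.
Proof.
move=> E; have mem u : u \in W -> exists2 u', u' \in W' & x + u = y + u'.
  move=> uW; have : [set y + u | u in [set` W']]%classic (x + u).
    by rewrite -E; exists u.
  by move=> [u' u'W E']; exists u'.
have [u0 u0W' E0] := mem 0 (mem0v _).
apply/subvP => u /mem[u1 u1W' E1].
have -> : u = u1 - u0.
  by apply: (addrI x); rewrite E1 -[x in RHS](addr0 x) E0 -addrA subrKC.
exact: memvB.
Qed.

Lemma has_dim_hull o A d : o \in A ->
  has_dim (hull A) d <-> d = (\dim (directions o A))%:Z.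
Proof.
move=> oA; split=> [[[h0 _]|[x [W [hE ->]]]]|->].
- by have := hull_vertex oA; rewrite h0.
- rewrite (affine_hull_directions oA) in hE.
  suff -> : W = directions o A by [].
  apply/eqP; rewrite eqEsubv.
  by rewrite (translate_inj hE) (translate_inj (esym hE)).
by right; exists (v o), (directions o A); split=> //; exact: affine_hull_directions.
Qed.

Lemma height_translate c b x u : height c b (x + u) = height c b x - (u *m c) 0 0.
Proof. by rewrite /height mulmxDl mxE; ring. Qed.

Lemma directions_zero o A c b u : o \in A ->
  (forall i, i \in A -> height c b (v i) = 0) -> u \in directions o A ->
  (u *m c) 0 0 = 0.
Proof.
move=> oA hA uW; have : height c b (v o + u) = 0.
  apply: (affine_hull_height hA); rewrite (affine_hull_directions oA).
  by exists u.
by rewrite height_translate hA // sub0r => /eqP; rewrite oppr_eq0 => /eqP.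
Qed.

Lemma dim_add_line (W : {vspace 'rV[R]_n}) u : u \notin W ->
  \dim (W + <[u]>) = (\dim W).+1.
Proof.
move=> uW; have u0 : u != 0 by apply: contraNneq uW => ->; rewrite mem0v.
rewrite dimv_disjoint_sum ?dim_vline ?u0 ?addn1 //.
apply/eqP; rewrite -subv0; apply/subvP => y; rewrite memv_cap memv0.
case/andP=> yW /vlineP[k yE]; apply: contraNT uW => y0.
have k0 : k != 0 by apply: contraNneq y0 => k0; rewrite yE k0 scale0r.
have -> : u = k^-1 *: y by rewrite yE scalerA mulVf // scale1r.
exact: memvZ.
Qed.

(** Let j be an index with g j != 0. Being a facet function means that the
    directions of the zeros of g and v j - v o span all directions: a
    direction outside this span would be detected by a linear form that vanishes on
    the zeros of g and is not proportional to g. *)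
Lemma facet_fun_dim o g : affine_fun g -> (forall i, 0 <= g i) -> o \in zeros g ->
  facet_fun affine_fun g <->
  \dim (directions o [set: 'I_N]) = (\dim (directions o (zeros g))).+1.
Proof.
move=> Ug g0 oZ; have [c [b gE]] := Ug.
set W1 := directions o (zeros g); set W0 := directions o _.
have W01 : (W1 <= W0)%VS.
  by apply: sub_directions => i _; apply: mem_directions; rewrite inE.
have zero_lin c' b' u : (forall i, i \in zeros g -> height c' b' (v i) = 0) ->
    u \in W1 -> (u *m c') 0 0 = 0 by exact: directions_zero.
have gZ i : i \in zeros g -> height c b (v i) = 0.
  by rewrite -gE in_zeros => /eqP.
have val c' b' i : height c' b' (v o) = 0 -> 
    height c' b' (v i) = - ((v i - v o) *m c') 0 0.
  by move=> ho; rewrite -[v i in LHS](subrKC (v o)) height_translate ho sub0r.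
have out j : g j != 0 -> v j - v o \notin W1.
  apply: contra => /(zero_lin c b _ gZ) E.
  by rewrite gE (val c b) ?gZ // E oppr0.
split=> [[_ _ [j gj] gP]|dimE].
  rewrite -(dim_add_line (out j gj)); congr (\dim _); apply/eqP.
  rewrite eqEsubv subv_add W01 -memvE mem_directions ?in_setT // !andbT.
  apply: sub_directions => i _; pose k := g i / g j.
  rewrite -[v i - v o](subrK (k *: (v j - v o))).
  apply: memv_add; last by apply: memvZ; exact: memv_line.
  apply/negPn/negP => /separating_functional[c' [c'W c'z]].
  pose h i := height c' ((v o *m c') 0 0) (v i).
  have ho : height c' ((v o *m c') 0 0) (v o) = 0 by rewrite /height subrr.
  have [||l hl] := gP h; first by exists c', ((v o *m c') 0 0).
    move=> m mZ; rewrite /h (val c') //.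
    by rewrite c'W ?mem_directions // mxE oppr0.
  move/negP: c'z; apply; rewrite mulmxBl -scalemxAl [X in X == 0]mxE.
  rewrite [X in _ + X]mxE [X in _ - X]mxE.
  have hE m : ((v m - v o) *m c') 0 0 = - h m by rewrite /h (val c') // opprK.
  by rewrite !hE !hl /k; apply/eqP; field.
have [j gj] : exists j, g j != 0.
  apply: contrapT => H; have ZT : zeros g = [set: 'I_N].
    apply/setP => i; rewrite in_zeros inE; apply/negPn/negP => gi.
    by apply: H; exists i.
  by move/eqP: dimE; rewrite /W0 /W1 ZT ltn_eqF.
split=> //; first by exists j.
have W0E : W0 = (W1 + <[v j - v o]>)%VS.
  apply/eqP; rewrite eq_sym eqEdim subv_add W01 -memvE mem_directions ?inE //=.
  by rewrite dim_add_line ?out // dimE.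
move=> h [c' [b' hE]] hZ; exists (h j / g j) => i.
have h0 m : m \in zeros g -> height c' b' (v m) = 0 by rewrite -hE; exact: hZ.
have : v i - v o \in W0 by rewrite mem_directions ?inE.
rewrite W0E => /memv_addP[u uW1 [_ /vlineP[k ->] E]].
have lin (c1 : 'cV[R]_n) : ((u + k *: (v j - v o)) *m c1) 0 0 =
    (u *m c1) 0 0 + k * ((v j - v o) *m c1) 0 0.
  by rewrite mulmxDl -scalemxAl [LHS]mxE [X in _ + X]mxE.
have gi : g i = k * g j.
  rewrite !gE (val c b i (gZ o oZ)) (val c b j (gZ o oZ)) E lin.
  by rewrite (zero_lin c b u gZ uW1) add0r mulrN.
have hi : h i = k * h j.
  rewrite !hE (val c' b' i (h0 o oZ)) (val c' b' j (h0 o oZ)) E lin.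
  by rewrite (zero_lin c' b' u h0 uW1) add0r mulrN.
by rewrite gi hi; field.
Qed.

(** A facet without vertices only occurs in a polytope reduced to a point,
    where the empty face has codimension one. *)
Lemma point_dim o : (forall i, v i = v o) -> \dim (directions o [set: 'I_N]) = 0%N.
Proof.
move=> vo; apply/eqP; rewrite dimv_eq0 -subv0; apply: sub_directions => i _.
by rewrite vo subrr mem0v.
Qed.

Lemma facet_hullP F : facet (hull [set: 'I_N]) F <->
  exists g, facet_fun affine_fun g /\ F = hull (zeros g).
Proof.
split=> [[/face_hullP[g [Ug g0 FE]] [d dP dF]]|[g [fg ->]]].
  exists g; split=> //; have [Z0|/set0Pn[o oZ]] := eqVneq (zeros g) set0.
    have d0 : d = 0.
      by move: dF; rewrite FE Z0 => /has_dim_hull0 E; rewrite -(subrK 1 d) E.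
    have [T0|/set0Pn[o oT]] := eqVneq [set: 'I_N] set0.
      by move: dP; rewrite d0 T0 => /has_dim_hull0.
    move: dP; rewrite d0 => /(has_dim_hull _ oT)/esym/eqP.
    rewrite (eqz_nat _ 0) dimv_eq0 => /eqP W0.
    have vo i : v i = v o.
      apply/eqP; rewrite -subr_eq0 -memv0 -W0.
      by apply: mem_directions; rewrite inE.
    have go : g o != 0.
      by rewrite -in_zeros Z0 inE.
    split=> //; first by exists o.
    move=> h [c' [b' hE]] _; have [c [b gE]] := Ug; exists (h o / g o) => i.
    have -> : g i = g o by rewrite !gE vo.
    by rewrite divfK // !hE vo.
  apply/(facet_fun_dim Ug g0 oZ).
  move: dP => /(has_dim_hull _ (in_setT o)) dP.
  move: dF; rewrite FE => /(has_dim_hull _ oZ) dF.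
  by apply/eqP; rewrite -eqz_nat -dP -addn1 PoszD -dF subrK.
have [Ug g0 [j gj] gP] := fg; split.
  by apply/face_hullP; exists g.
have [Z0|/set0Pn[o oZ]] := eqVneq (zeros g) set0.
  exists 0; last by rewrite Z0; apply/has_dim_hull0.
  apply/(has_dim_hull _ (in_setT j)); rewrite point_dim // => i.
  have prop c b : exists l, forall m, height c b (v m) = l * g m.
    apply: (gP (fun m => height c b (v m))); first by exists c, b.
    by move=> m; rewrite Z0 inE.
  have gi : g i = g j.
    have [l hl] := prop 0 1; have E m : l * g m = 1.
      by rewrite -hl /height mulmx0 mxE subr0.
    have l0 : l != 0.
      by apply/eqP => l0; move/eqP: (E i); rewrite l0 mul0r eq_sym oner_eq0.
    by apply: (mulfI l0); rewrite !E.
  apply/eqP/negPn/negP => vij.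
  have [|c [_ cz]] := @separating_functional 0%VS (v i - v j).
    by rewrite memv0 subr_eq0.
  have [l hl] := prop c 0; move/negP: cz; apply.
  have := hl i; rewrite gi -hl /height !sub0r mulmxBl => /oppr_inj E.
  by rewrite [X in X == 0]mxE [X in _ + X]mxE E subrr.
exists (\dim (directions o [set: 'I_N]))%:Z.
  exact/has_dim_hull.
apply/(has_dim_hull _ oZ); have /(facet_fun_dim Ug g0 oZ) -> := fg.
by rewrite -addn1 PoszD addrK.
Qed.

End Hulls.

(** * Vertices of polytopes with simplicial facets *)

Section Vertices.
Local Open Scope ring_scope.
Variables (R : realType) (n N : nat) (v : 'I_N -> 'rV[R]_n).
Implicit Types (A : {set 'I_N}) (i m : 'I_N).

(** Expand each w j in the points v. If the total weight of v i is less
    than 1, solving for v i puts it in the hull of the others; if it is 1, the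
    points w j with a positive coefficient are v i itself. *)
Lemma extreme_combination i k (w : 'I_k -> 'rV[R]_n) (r : 'I_k -> R) :
  ~ hull v [set~ i] (v i) -> (forall j, hull v [set: 'I_N] (w j)) ->
  (forall j, 0 <= r j) -> \sum_j r j = 1 -> v i = \sum_j r j *: w j ->
  exists j, w j = v i.
Proof.
move=> vi wP r0 r1 viE; have /choice[a aP] := wP.
have a0 j m : 0 <= a j m by have [] := aP j.
have a1 j : \sum_m a j m = 1 by have [] := aP j.
have wE j : w j = \sum_m a j m *: v m by have [] := aP j.
pose g m := \sum_j r j * a j m.
have g0 m : 0 <= g m by apply: sumr_ge0 => j _; exact: mulr_ge0.
have g1 : \sum_m g m = 1.
  rewrite exchange_big /= -r1; apply: eq_bigr => j _.
  by rewrite -mulr_sumr a1 mulr1.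
have vE : v i = \sum_m g m *: v m.
  rewrite viE; under eq_bigr do rewrite wE scaler_sumr.
  rewrite exchange_big /=; apply: eq_bigr => m _; rewrite scaler_suml.
  by apply: eq_bigr => j _; rewrite scalerA.
have rest : \sum_(m | m != i) g m = 1 - g i.
  by rewrite -g1 [in RHS](bigD1 i) //= addrAC subrr add0r.
have rest0 : 0 <= 1 - g i by rewrite -rest sumr_ge0.
have [gi1|gi1] := eqVneq (g i) 1; last first.
  case: vi; have gn : 1 - g i != 0 by rewrite subr_eq0 eq_sym.
  exists (fun m => if m == i then 0 else g m / (1 - g i)); split.
  - by move=> m; case: ifP => // _; rewrite divr_ge0.
  - by move=> m; rewrite !inE negbK => ->.
  - transitivity ((\sum_(m | m != i) g m) / (1 - g i)); last by rewrite rest divff.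
    by rewrite (bigD1 i) //= eqxx add0r mulr_suml; apply: eq_bigr => m /negbTE->.
  - apply: (scalerI gn); rewrite [in LHS]scalerBl scale1r {1}vE (bigD1 i) //=.
    rewrite addrAC subrr add0r scaler_sumr [RHS](bigD1 i) //=.
    rewrite eqxx scale0r scaler0 add0r.
    by apply: eq_bigr => m /negbTE->; rewrite scalerA mulrC divfK.
have [j rj] : exists j, r j != 0.
  apply: contrapT => H; move/eqP: r1; rewrite big1 ?(eq_sym 0) ?oner_eq0 // => j _.
  by apply/eqP/negPn/negP => rj; apply: H; exists j.
have aji_le l : a l i <= 1.
  by rewrite -(a1 l) (bigD1 i) //= lerDl sumr_ge0.
have aji : a j i = 1.
  have : \sum_l r l * (1 - a l i) = 0.
    under eq_bigr do rewrite mulrBr mulr1.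
    by rewrite sumrB r1 -[X in _ - X]/(g i) gi1 subrr.
  move/eqP; rewrite psumr_eq0 => [/allP/(_ j (mem_index_enum _))|m _].
    by rewrite /= mulf_eq0 (negbTE rj) /= subr_eq0 eq_sym => /eqP.
  by rewrite mulr_ge0 // subr_ge0.
exists j; rewrite wE (bigD1 i) //= aji scale1r big1 ?addr0 // => m mi.
have : \sum_(m | m != i) a j m = 0.
  by apply: (addrI (a j i)); rewrite -(bigD1 i (P := xpredT)) //= a1 aji addr0.
move/eqP; rewrite psumr_eq0 // => /allP/(_ m (mem_index_enum _)).
by rewrite mi /= => /eqP->; rewrite scale0r.
Qed.

(** The points v i with i in A are extreme, so they are among the vertices of
    the simplex, and the dual affine functions of the latter are the coordinates. *)
Lemma simplex_coords A i : (forall j, ~ hull v [set~ j] (v j)) ->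
  simplex (hull v A) -> i \in A ->
  exists h, [/\ affine_fun v h, h i = 1 & forall j, j \in A -> j != i -> h j = 0].
Proof.
move=> vext [k [w [iw AE]]] iA.
have wA j : hull v A (w j) by rewrite AE; apply: sub_gen_smallest; exists j.
have vw m : m \in A -> exists j, w j = v m.
  move=> mA; have := hull_vertex v mA; rewrite AE convex_hullE => -[r [r0 _ r1 E]].
  apply: (extreme_combination (vext m) _ r0 r1 E) => j.
  exact: (hullS (subsetT A) (wA j)).
have [ji wi] := vw i iA.
have [c [b cb]] := affinely_independent_dual ji iw.
exists (fun m => height c b (v m)); split; first by exists c, b.
  by rewrite -wi cb eqxx.
move=> m mA mi; have [jm wm] := vw m mA; rewrite -wm cb.
case: eqP => // jE; case: (vext i); rewrite -wi -jE wm.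
by apply: hull_vertex; rewrite !inE.
Qed.

End Vertices.

Section Minimal.
Local Open Scope ring_scope.
Variables (R : realType) (n : nat).

(** A generating family of minimal size has no redundant point. *)
Lemma polytope_vertices (P : set 'rV[R]_n) : polytope P ->
  exists N (v : 'I_N -> 'rV[R]_n),
    P = hull v [set: 'I_N] /\ forall i, ~ hull v [set~ i] (v i).
Proof.
move=> [V /finite_seqP[s ->] PE].
pose gen N := `[<exists v : 'I_N -> 'rV[R]_n, P = hull v [set: 'I_N]>].
have ex : exists N, gen N.
  exists (size s); apply/asboolP; exists (fun i => nth 0 s i).
  rewrite -convex_hullE PE; congr convex_hull; apply/seteqP; split=> x /=.
    move=> xs; exists (Ordinal (etrans (index_mem x s) xs)) => //=.
    by rewrite nth_index.
  by move=> [i _ <-]; rewrite /= mem_nth.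
case: (ex_minnP ex) => N /asboolP[v PEv] minN.
exists N, v; split=> // i hi; case: N v PEv minN i hi => [|N] v PEv minN i hi.
  by case: i hi.
suff /minN : gen N by rewrite ltnn.
apply/asboolP; exists (fun j => v (lift i j)); rewrite PEv.
have lower :
    (hull v [set~ i] `<=` hull (fun j => v (lift i j)) [set: 'I_N])%classic.
  apply: hull_min; first exact: hull_convex.
  move=> m; rewrite !inE eq_sym => /unlift_some[j -> _].
  by apply: (hull_vertex (fun j => v (lift i j))); rewrite inE.
apply/seteqP; split; apply: hull_min; try exact: hull_convex.
- move=> m _; have [->|mi] := eqVneq m i; first exact: lower.
  by apply: lower; apply: hull_vertex; rewrite !inE.
- by move=> j _; apply: hull_vertex; rewrite inE.
Qed.

End Minimal.

(** * Hamilton cycles of face lattices *)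

Lemma prev_at_last (T : eqType) (x y : T) p :
  x \notin p -> prev_at x x y p = last y p.
Proof.
elim: p y => [|z p IH] y /=; first by rewrite eqxx.
by rewrite inE negb_or => /andP[/negbTE->]; exact: IH.
Qed.

Local Open Scope classical_set_scope.

Theorem theorem2 (R : realType) (n : nat) (P F G : set 'rV[R]_n) :
  polytope P -> simplicial P ->
  facet P F -> facet P G -> F <> G ->
  exists c : seq (set 'rV[R]_n),
    hamilton_cycle (face_lattice P) (cover_adj (face_lattice P)) c /\
    [set prev c P; next c P] = [set F; G].
Proof.
move=> /polytope_vertices[N [v [-> vext]]] simp.
move=> /facet_hullP[gF [fF ->]] /facet_hullP[gG [fG ->]] nFG.
set K := hull v; set L := face_lattice _; set T := [set: 'I_N]%SET in L *.
have coords g a : facet_fun (affine_fun v) g -> a \in zeros g ->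
    exists h, [/\ affine_fun v h, h a = 1%R &
                  forall i, i \in zeros g -> i != a -> h i = 0%R].
  move=> fg; apply: simplex_coords => //; apply: simp.
  by apply/facet_hullP; exists g.
have nz : zeros gF != zeros gG by apply/eqP => E; apply: nFG; rewrite E.
have lin := @affine_fun_lin R n N v.
have [s [srt un ins hd ls]] := facet_fun_walk lin coords fF fG nz.
(* The sets in the walk are zero sets, whence the order on the faces is the
   inclusion of these sets. *)
have supp A : A \in s -> exists f, [/\ affine_fun v f, forall i, (0 <= f i)%R,
    zeros f = A & A != T].
  move=> /ins[g fg Ag]; have [f [Uf f0 zf]] := subface lin coords fg Ag.
  exists f; split=> //; have [_ _ [i gi] _] := fg; apply: contra gi => /eqP AT.
  by rewrite -in_zeros (subsetP Ag) // AT inE.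
have Ksub A B : B \in s -> K A `<=` K B -> A \subset B.
  by move=> /supp[f [Uf f0 zf _]]; exact: (hull_subP Uf f0 (esym zf)).
have KT A : A \in s -> ~ K T `<=` K A.
  move=> As /(Ksub _ _ As); rewrite finset.subTset => /eqP AT.
  by have [f [_ _ _]] := supp A As; rewrite AT eqxx.
have Klt A B : A \in s -> B \in s -> A \proper B -> (K A < K B)%O.
  move=> As Bs /fintype.properP[AB [i iB iA]]; rewrite properEset; split.
    exact: hullS.
  by move=> /(Ksub _ _ As)/fintype.subsetP/(_ i iB); exact: negP.
have faceP X : L X <-> X = K T \/ exists2 A, A \in s & X = K A.
  split=> [/face_hullP[g [Ug g0 ->]]|[->|[A /supp[f [Uf f0 zf _]] ->]]].
  - have [gn0|gz] := pselect (exists i, g i != 0%R).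
      have [g' [fg' gg']] := under_facet lin Ug g0 gn0.
      by right; exists (zeros g) => //; apply/ins; exists g'.
    left; congr hull; apply/setP => i; rewrite in_zeros inE.
    by apply/negPn/negP => gi; apply: gz; exists i.
  - apply/face_hullP; exists (fun=> 0%R); split=> //.
      by exists 0%R, 0%R => i; rewrite /height mulmx0 mxE subr0.
    by congr hull; apply/setP => i; rewrite in_zeros inE eqxx.
  - by apply/face_hullP; exists f; rewrite zf.
have LK A : A \in s -> L (K A) by move=> As; apply/faceP; right; exists A.
have LT : L (K T) by apply/faceP; left.
have cov A B : A \in s -> B \in s -> B \subset A -> adjacent A B ->
    covers L (K B) (K A).
  move=> As Bs BA; rewrite adjacent_sym => adj.
  have [x xA BE] := adjacent_sub adj BA.
  have BpA : B \proper A by rewrite BE properD1.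
  split; [exact: LK | exact: LK | exact: Klt | move=> [X [/faceP LX BX XA]]].
  case: LX => [XT|[C Cs XC]].
    by apply: (KT A As); rewrite -subsetEset -XT ltW.
  rewrite XC in BX XA.
  have BC : B \subset C by apply: Ksub => //; rewrite -subsetEset ltW.
  have CA : C \subset A by apply: Ksub => //; rewrite -subsetEset ltW.
  have [xC|xC] := boolP (x \in C).
    have CE : C = A.
      by apply/eqP; rewrite eqEsubset CA -(setD1K xA) subUset sub1set xC -BE.
    by move: XA; rewrite CE ltxx.
  have CE : C = B by apply/eqP; rewrite eqEsubset BC andbT BE subsetD1 CA xC.
  by move: BX; rewrite CE ltxx.
(* A face that contains a facet is below another one, whose function is then a
   multiple of that of the first. *)
have covT A g : A \in s -> facet_fun (affine_fun v) g -> A = zeros g ->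
    covers L (K A) (K T).
  move=> As fg AE; split=> //; first exact: LK.
    by rewrite properEset; split; [apply: hullS; exact: finset.subsetT | exact: KT].
  move=> [X [/faceP LX AX XT]]; case: LX => [XE|[C Cs XC]].
    by move: XT; rewrite XE ltxx.
  rewrite XC in AX.
  have AC : A \subset C by apply: Ksub => //; rewrite -subsetEset ltW.
  have [g' [Ug' _ g'n0 _] Cg'] := (ins C).1 Cs.
  have zE : zeros g' = zeros g.
    apply: (facet_fun_maximal fg) => //; rewrite -AE.
    exact: fintype.subset_trans Cg'.
  have CE : C = A by apply/eqP; rewrite eqEsubset AC andbT AE -zE.
  by move: AX; rewrite CE ltxx.
have adjK A B : A \in s -> B \in s -> adjacent A B -> cover_adj L (K A) (K B).
  move=> As Bs adj; have := adj; rewrite {1}/adjacent.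
  case E: #|A :\: B| => [|m].
    move/eqP: E; rewrite cards_eq0 setD_eq0 => AB _; left.
    by apply: cov => //; rewrite adjacent_sym.
  rewrite addSn eqSS addn_eq0 cards_eq0 setD_eq0 => /andP[_ BA]; right.
  exact: cov.
have Ps : K T \notin [seq K A | A <- s].
  by apply/mapP => -[A As E]; apply: (KT A As); rewrite -E.
have Kinj : {in s &, injective K}.
  move=> A B As Bs E; apply/eqP; rewrite eqEsubset.
  by rewrite !Ksub // E.
have Fs : zeros gF \in s by apply/ins; exists gF.
have Gs : zeros gG \in s by apply/ins; exists gG.
have [A [s' sE]] : exists A s', s = A :: s'.
  by case: (s) Fs => // A s' _; exists A, s'.
have AF : A = zeros gF by move: hd; rewrite sE.
have lG : last A s' = zeros gG by move: ls; rewrite sE.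
set e := [rel X Y | `[< cover_adj L X Y >]].
have eK : path e (K A) [seq K B | B <- s'].
  rewrite -[path _ _ _]/(sorted e [seq K B | B <- A :: s']) -sE sorted_map.
  apply: (sub_in_sorted (P := mem s)) srt; last exact/allP.
  by move=> B C /= Bs Cs adj; apply/asboolP; exact: adjK.
exists (K T :: [seq K B | B <- s]); split; first split.
- rewrite /ucycle; apply/andP; split.
    rewrite sE /= rcons_path eK last_map lG /=; apply/andP; split; apply/asboolP.
      by right; apply: (covT A gF) => //; rewrite AF.
    by left; apply: (covT _ gG).
  by rewrite /= Ps map_inj_in_uniq.
- rewrite /= size_map ltnS.
  apply: uniq_leq_size (_ : uniq [:: zeros gF; zeros gG]) _.
    by rewrite /= inE nz.
  by move=> B; rewrite !inE => /orP[]/eqP->.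
- apply/seteqP; split=> X /=.
    by rewrite inE => /predU1P[->//|/mapP[B Bs ->]]; exact: LK.
  move=> /faceP[->|[B Bs ->]]; first by rewrite mem_head.
  by rewrite inE map_f ?orbT.
have -> : next (K T :: [seq K B | B <- s]) (K T) = K (zeros gF).
  by rewrite sE /= eqxx AF.
have -> : prev (K T :: [seq K B | B <- s]) (K T) = K (zeros gG).
  by rewrite /= prev_at_last // sE /= last_map lG.
by rewrite classical_sets.setUC.
Qed.
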